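(* Let $d\ge 3$ and let $P\subset\mathbb{R}^d$ be a $d$-dimensional convex lattice polytope with Ehrhart polynomial $\mathrm{G}(kP)=\sum_{i=0}^d \mathrm{g}_i(P)\,k^i$. Then: (i) $\displaystyle \mathrm{g}_1(P)\ge 1+\frac12+\cdots+\frac1{d-2}+\frac{2}{d-1}-(d-2)!\,\mathrm{vol}(P)$; (ii) $\displaystyle \mathrm{g}_2(P)\ge \frac{(-1)^d}{d!}\Big\{\mathrm{stirl}(d+1,3)+\big((-1)^d(d-2)!+\mathrm{stirl}(d-1,2)\big)\big(d!\,\mathrm{vol}(P)-1\big)\Big\}$; (iii) $\displaystyle \mathrm{g}_{d-2}(P)\ge \frac{1}{d!}\,\frac{(d-1)d(d+1)}{24}\big\{3(d+1)-d!\,\mathrm{vol}(P)\big\}$ if $d$ is odd, and $\displaystyle \mathrm{g}_{d-2}(P)\ge \frac{1}{d!}\,\frac{(d-1)d}{24}\big\{3d(d+2)-(d-2)\,d!\,\mathrm{vol}(P)\big\}$ if $d$ is even. Moreover, the bounds are best possible for any volume: for every $d\ge3$, every positive integer $m$, and each of the inequalities (i), (ii), (iii), there is a $d$-dimensional convex lattice polytope $P\subset\mathbb{R}^d$ with $\mathrm{vol}(P)=m/d!$ for which that inequality holds with equality.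
   Context: A $d$-dimensional convex lattice polytope is a convex polytope $P\subset\mathbb{R}^d$ with $\dim P=d$, all of whose vertices lie in $\mathbb{Z}^d$ (its volume is always a positive integer multiple of $1/d!$). For $S\subset\mathbb{R}^d$, $\mathrm{G}(S)=\#(S\cap\mathbb{Z}^d)$. By Ehrhart's theorem, for $k\in\mathbb{N}$, $\mathrm{G}(kP)=\sum_{i=0}^d \mathrm{g}_i(P)k^i$ is a polynomial of degree $d$ in $k$ whose coefficients $\mathrm{g}_i(P)$ depend only on $P$. $\mathrm{vol}$ is the $d$-dimensional Lebesgue measure on $\mathbb{R}^d$. $\mathrm{stirl}(n,j)$ are the (signed) Stirling numbers of the first kind, defined by $\prod_{i=0}^{n-1}(z-i)=\sum_{j=1}^n \mathrm{stirl}(n,j)z^j$. In (i) the sum $1+\frac12+\cdots+\frac{1}{d-2}$ means $\sum_{j=1}^{d-2}\frac1j$. *)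

(* Defs.v *)
From HB Require Import structures.
From mathcomp Require Import all_boot all_order all_algebra finmap.
From mathcomp Require Import all_classical all_reals all_analysis.

Set Implicit Arguments.
Unset Strict Implicit.
Unset Printing Implicit Defensive.

Import Order.TTheory GRing.Theory Num.Theory.
Import numFieldNormedType.Exports.

Local Open Scope classical_set_scope.
Local Open Scope ring_scope.

Section Polytopes.
Variables (R : realType) (d : nat).
Implicit Types (S P : set 'rV[R]_d) (x y v : 'rV[R]_d).

Definition lattice_point x : Prop := forall i, x 0 i \is a Num.int.

Definition convex_hull n (V : 'I_n -> 'rV[R]_d) : set 'rV[R]_d :=
  [set x | exists a : 'I_n -> R,
     [/\ forall i, 0 <= a i, \sum_i a i = 1 & x = \sum_i a i *: V i]].

Definition convex_polytope P : Prop :=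
  exists (n : nat) (V : 'I_n -> 'rV[R]_d), P = convex_hull V.

(* Vertices are the extreme points. *)
Definition vertex P v : Prop :=
  P v /\ forall x y (t : R), P x -> P y -> 0 < t < 1 ->
           v = t *: x + (1 - t) *: y -> x = v /\ y = v.

Definition convex_lattice_polytope P : Prop :=
  convex_polytope P /\ forall v, vertex P v -> lattice_point v.

(* The largest k such that S contains k + 1 affinely independent points
   x0, x0 + row 0 A, ..., x0 + row (k - 1) A.  The empty set gets
   dimension 0. *)
Definition affine_dim S : nat :=
  \max_(k < d.+1 | `[< exists (x0 : 'rV[R]_d) (A : 'M[R]_(k, d)),
      [/\ S x0, forall i, S (x0 + row i A) & row_free A] >]) k.

(* Number of lattice points of S (0 if there are infinitely many, since
   fset_set sends infinite sets to fset0). *)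
Definition lattice_count S : nat := #|` fset_set (S `&` lattice_point) |.

Definition dilate (k : nat) S : set 'rV[R]_d := [set k%:R *: x | x in S].

(* Lebesgue outer measure on R^d: infimum of the total volumes of the
   countable coverings by boxes. It agrees with the Lebesgue measure on
   measurable sets, in particular on polytopes. *)
Definition lebesgue_rV S : \bar R :=
  ereal_inf [set l : \bar R | exists a b : nat -> 'rV[R]_d,
    [/\ forall n i, a n 0 i <= b n 0 i,
        S `<=` \bigcup_n
              [set x : 'rV[R]_d | forall i, a n 0 i <= x 0 i <= b n 0 i] &
        l = (\sum_(0 <= n <oo) (\prod_(i < d) (b n 0 i - a n 0 i))%:E)%E]].

Definition vol S : R := fine (lebesgue_rV S).

(* A polynomial is determined by its values on the natural numbers, so xget
   picks the only candidate; one exists for every lattice polytope by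
   Ehrhart's theorem. The default 0 is used only if there is none. *)
Definition ehrhart_poly P : {poly R} :=
  xget 0 [set p : {poly R} |
            forall k : nat, (lattice_count (dilate k P))%:R = p.[k%:R]].

Definition ehrhart_coef (i : nat) P : R := (ehrhart_poly P)`_i.

End Polytopes.

(* Signed Stirling number of the first kind, as the coefficient of z^j in
   z (z - 1) ... (z - n + 1). *)
Definition stirl (n j : nat) : int :=
  (\prod_(i < n) ('X - (i%:R)%:P) : {poly int})`_j.

(* The lower bounds for the Ehrhart coefficients g_1, g_2 and g_(d-2) of a
   d-dimensional lattice polytope of volume v. *)
Section Bounds.
Variables (R : realType) (d : nat) (v : R).

Definition g1_bound : R :=
  \sum_(1 <= j < (d - 2).+1) j%:R^-1 + 2 / (d - 1)%:R - (d - 2)`!%:R * v.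

Definition g2_bound : R :=
  (-1) ^+ d / d`!%:R *
    ((stirl (d + 1) 3)%:~R
     + ((-1) ^+ d * (d - 2)`!%:R + (stirl (d - 1) 2)%:~R)
       * (d`!%:R * v - 1)).

Definition gdm2_bound : R :=
  if odd d then
    1 / d`!%:R * (((d - 1) * d * (d + 1))%:R / 24)
      * (3 * (d + 1)%:R - d`!%:R * v)
  else
    1 / d`!%:R * (((d - 1) * d)%:R / 24)
      * (3 * d%:R * (d + 2)%:R - (d - 2)%:R * d`!%:R * v).

End Bounds.

(* Main.v *)
Require Import Defs.
From HB Require Import structures.
From mathcomp Require Import all_boot all_order all_algebra finmap.
From mathcomp Require Import all_classical all_reals all_analysis.
From mathcomp Require Import zify ring lra.

(** Let h_0, ..., h_d be the coefficients of the numerator of the Ehrhart series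
of P, so that G(k P) is the sum of the h_j binomial(k + d - j, d). Then
g_i(P) is a fixed linear combination of the h_j: up to the factor 1 / d!,
the weight of h_j is the coefficient of X ^ i in the product of the X + d -
j - l for l < d. The bounds follow from four facts: h_0 = 1, the h_j are
nonnegative, their sum is d! vol(P), and h_d <= h_1. Indeed, bound the
weights with j > 0 from below by one of them. For g_1 and g_2 the weight at
j = 2 is the least one for 2 <= j < d, and the weights at 1 and d, which are
equal or opposite, contribute a nonnegative amount because h_d <= h_1; for
g_(d-2) the weight is a quadratic function of the mean of the numbers d - j
- l, so that it is least in the middle ([hstar_bound], [lower_bounds]).
Equality holds when the mass of h is concentrated at 0 and at the index of
the least weight, which is achieved by simplices whose nonzero box points
all have the same height ([exists_sharp_simplex]).

To obtain the h_j, P is placed at height 1 and replaced by the cone over it.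
Generic costs of the vertices define a regular triangulation: its cells are
the bases for which the linear functional interpolating the costs stays
below the costs of the other vertices. Shifting all the points by a small
multiple of a generic vector y of the cone assigns each point to one cell,
and makes the cone a disjoint union of half-open simplicial cones
([exists_half_open_partition]). In such a cone each lattice point is in a
unique way the sum of a point of the half-open box and a nonnegative
integral combination of the generators, so that h_j counts the box points of
height j ([card_half_open_cone], [ehrhart_hstar]).

For h_d <= h_1, subtract the box points of height d from the sum of the
generators of their cells. This gives distinct lattice points of P, because
they belong to the half-open cells for the direction - y; and none of them
is a vertex of P, as a vertex shifted by a small multiple of - y leaves the
cone. Hence h_d is at most the number of lattice points minus d + 1, which
is h_1 ([hstar_last]).

The volume is defined by coverings with boxes. Covering P by the cubes of a
grid of side 1/k that meet it bounds k ^ d vol(P) from above by the number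
of lattice points of a slightly larger dilate; conversely, compactness
reduces a covering to finitely many boxes, in which the lattice points are
counted ([vol_convex_hull]). *)

Set Implicit Arguments.
Unset Strict Implicit.
Unset Printing Implicit Defensive.

Import Order.TTheory GRing.Theory Num.Theory.
Import numFieldNormedType.Exports.

Local Open Scope classical_set_scope.
Local Open Scope ring_scope.

(** * Counting lattice points *)

Section LatticePoints.
Variable R : realType.

Lemma card_fset_set_uniq (T : choiceType) (A : set T) (s : seq T) :
  uniq s -> (forall x, x \in s <-> A x) -> #|` fset_set A| = size s.
Proof.
move=> us sA; have -> : A = [set` [fset x in s]%fset].
  by apply/seteqP; split=> x /=; rewrite inE => /sA.
rewrite set_fsetK -(undup_id us) -card_fseq.
by congr #|` _|; apply/fsetP => x; rewrite !inE mem_undup.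
Qed.

Lemma fset_set_enum (T : choiceType) (A : set T) : finite_set A ->
  exists s : seq T, [/\ uniq s, forall x, x \in s <-> A x &
                        size s = #|` fset_set A|].
Proof.
move=> fA; exists (enum_fset (fset_set A)); split=> // x.
by rewrite in_fset_set // inE.
Qed.

Lemma finite_set_seq (T : choiceType) (A : set T) (s : seq T) :
  (forall x, A x -> x \in s) -> finite_set A.
Proof.
by move=> As; apply: (@sub_finite_set _ _ [set x | x \in s]).
Qed.

Lemma card_fset_set_sub (T : choiceType) (A : set T) (s : seq T) :
  (forall x, A x -> x \in s) -> (#|` fset_set A| <= size s)%N.
Proof.
move=> As; have [t [ut tA <-]] := fset_set_enum (finite_set_seq As).
by apply: uniq_leq_size => // x /tA /As.
Qed.

Lemma uniq_flatten_map (I T : eqType) (s : seq I) (F : I -> seq T) :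
  uniq s -> (forall i, i \in s -> uniq (F i)) ->
  (forall i j x, i \in s -> j \in s -> x \in F i -> x \in F j -> i = j) ->
  uniq (flatten [seq F i | i <- s]).
Proof.
elim: s => //= i s IH /andP[is_ us] uF dF; rewrite cat_uniq uF ?mem_head //=.
apply/andP; split.
  apply/hasPn => x /flattenP[_ /mapP[j js ->] xj]; apply/negP => xi.
  have e : i = j by apply: (dF i j x) => //;
    rewrite ?mem_head // in_cons js orbT.
  by rewrite e js in is_.
apply: IH => // [j js|j k x js ks]; first by rewrite uF // in_cons js orbT.
by apply: dF; rewrite in_cons ?js ?ks orbT.
Qed.

Lemma card_fset_set_partition (I : finType) (T : choiceType) (J : {set I})
    (A : set T) (F : I -> set T) :
  (forall x, A x <-> exists2 i, i \in J & F i x) ->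
  (forall i j x, i \in J -> j \in J -> F i x -> F j x -> i = j) ->
  (forall i, i \in J -> finite_set (F i)) ->
  finite_set A /\ #|` fset_set A| = (\sum_(i in J) #|` fset_set (F i)|)%N.
Proof.
move=> AF dF fF; pose s i := enum_fset (fset_set (F i)).
have sP i x : i \in J -> x \in s i <-> F i x.
  by move=> iJ; rewrite in_fset_set ?inE //; exact: fF.
pose t := flatten [seq s i | i <- enum J].
have tA x : x \in t <-> A x.
  split=> [/flattenP[y /mapP[i + ->]]|/AF[i iJ Fx]].
    by rewrite mem_enum => iJ /sP Fx; apply/AF; exists i => //; exact: Fx.
  apply/flattenP; exists (s i); last by apply/sP.
  by apply/mapP; exists i; rewrite ?mem_enum.
have ut : uniq t.
  apply: uniq_flatten_map; [exact: enum_uniq|by move=> i _; exact: fset_uniq|].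
  move=> i j x; rewrite !mem_enum => iJ jJ xi xj.
  by apply: (dF _ _ x iJ jJ); apply/sP.
split; first by apply: (finite_set_seq (s := t)) => x /tA.
rewrite (card_fset_set_uniq ut tA) size_flatten /shape -map_comp sumnE big_map.
by rewrite big_enum.
Qed.

Lemma natr_dist_lt1 (m n : nat) : `|m%:R - n%:R : R| < 1 -> m = n.
Proof.
rewrite ltr_distl => /andP[nm mn]; apply/eqP.
rewrite eqn_leq -ltnS -(ltr_nat R) -natr1 mn -ltnS -(ltr_nat R).
by rewrite -natr1 -ltrBlDr.
Qed.

Lemma lattice_pointD m (x y : 'rV[R]_m) :
  lattice_point x -> lattice_point y -> lattice_point (x + y).
Proof. by move=> lx ly i; rewrite mxE rpredD. Qed.

Lemma lattice_pointB m (x y : 'rV[R]_m) :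
  lattice_point x -> lattice_point y -> lattice_point (x - y).
Proof. by move=> lx ly i; rewrite !mxE rpredB. Qed.

Lemma lattice_point_mul m p (a : 'rV[R]_m) (B : 'M[R]_(m, p)) :
  lattice_point a -> (forall i, lattice_point (row i B)) ->
  lattice_point (a *m B).
Proof.
move=> la lB j; rewrite mxE rpred_sum // => i _.
by apply: rpredM => //; have := lB i j; rewrite mxE.
Qed.

(** An interval of length l contains at most l + 1 integers; a box contains
the product of these numbers. *)
Lemma lattice_box_cover m (a b : 'rV[R]_m) : (forall i, a 0 i <= b 0 i) ->
  exists s : seq 'rV[R]_m,
    (forall x, lattice_point x -> (forall i, a 0 i <= x 0 i <= b 0 i) ->
       x \in s) /\
    (size s)%:R <= \prod_i (b 0 i - a 0 i + 1).
Proof.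
move=> ab; pose c i := Num.truncn (b 0 i - a 0 i).
have c_itv i : (c i)%:R <= b 0 i - a 0 i < (c i).+1%:R.
  by apply: truncn_itv; rewrite subr_ge0.
pose vec (f : {dffun forall i : 'I_m, 'I_(c i).+1}) : 'rV[R]_m :=
  \row_i ((Num.ceil (a 0 i))%:~R + (f i : nat)%:R).
exists (map vec (enum {dffun forall i : 'I_m, 'I_(c i).+1})); split.
  move=> x lx xab; have lt_f i :
      (Num.truncn (x 0%R i - (Num.ceil (a 0%R i))%:~R)%R < (c i).+1)%N.
    rewrite ltnS; apply: le_truncn; have /andP[_ ?] := xab i.
    by apply: lerB => //; exact: ceil_ge.
  pose f : {dffun forall i : 'I_m, 'I_(c i).+1} := [ffun i => Ordinal (lt_f i)].
  apply/mapP; exists f; first by rewrite mem_enum.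
  apply/rowP => i; rewrite mxE ffunE /=.
  suff nx : x 0 i - (Num.ceil (a 0 i))%:~R \is a Num.nat.
    by rewrite truncnK // addrC subrK.
  rewrite natrEint rpredB ?lx ?intr_int //=.
  have /intrP[z xz] := lx i; have /andP[+ _] := xab i; rewrite xz.
  by rewrite subr_ge0 ler_int ceil_le_int.
rewrite size_map -cardE card_dep_ffun.
have -> : foldr muln 1%N [seq #|'I_(c x).+1| | x : 'I_m] = (\prod_i (c i).+1)%N.
  rewrite foldrE big_image /=; apply: eq_bigr => i _; exact: card_ord.
rewrite natr_prod; apply: ler_prod => i _.
by rewrite ler0n /= -natr1 lerD2r; case/andP: (c_itv i).
Qed.

Lemma finite_lattice_bounded m (A : set 'rV[R]_m) (M : R) :
  (forall x, A x -> lattice_point x) ->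
  (forall x, A x -> forall i, `|x 0 i| <= M) -> finite_set A.
Proof.
move=> lA AM; have [|s [sA _]] := @lattice_box_cover m
  (const_mx (- `|M|)) (const_mx `|M|).
  by move=> i; rewrite !mxE ge0_cp.
apply: (finite_set_seq (s := s)) => x Ax; apply: sA => [|i]; first exact: lA.
by rewrite !mxE -ler_norml (le_trans (AM x Ax i)) // ler_norm.
Qed.

End LatticePoints.

(** * Half-open simplicial cones *)

Section HalfOpenCone.
Variables (R : realType) (d : nat).
Implicit Types (B : 'M[R]_d.+1) (N : pred 'I_d.+1) (x : 'rV[R]_d.+1).

Definition coords B x : 'rV[R]_d.+1 := x *m invmx B.

(** The facets opposite to the generators with index in N are removed. *)
Definition half_open_cone B N : set 'rV[R]_d.+1 :=
  [set x | forall i, if N i then 0 < coords B x 0 i else 0 <= coords B x 0 i].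

Definition half_open_box B N : set 'rV[R]_d.+1 :=
  [set x | lattice_point x /\ forall i,
     if N i then 0 < coords B x 0 i <= 1 else 0 <= coords B x 0 i < 1].

Definition level (k : nat) : set 'rV[R]_d.+1 := [set x | x 0 ord0 = k%:R].

Definition box_count B N (j : nat) : nat :=
  #|` fset_set (half_open_box B N `&` level j)|.

Definition lattice_basis B : Prop :=
  [/\ B \in unitmx, forall i, lattice_point (row i B) & forall i, B i ord0 = 1].

Lemma coordsK B x : B \in unitmx -> coords B x *m B = x.
Proof. by move=> uB; rewrite mulmxKV. Qed.

Lemma coords_mul B (a : 'rV[R]_d.+1) : B \in unitmx -> coords B (a *m B) = a.
Proof. by move=> uB; rewrite /coords mulmxK. Qed.

Lemma coordsD B x y i : coords B (x + y) 0 i = coords B x 0 i + coords B y 0 i.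
Proof. by rewrite /coords mulmxDl mxE. Qed.

Lemma coordsZ B c x i : coords B (c *: x) 0 i = c * coords B x 0 i.
Proof. by rewrite /coords -scalemxAl mxE. Qed.

Lemma coordsN B x i : coords B (- x) 0 i = - coords B x 0 i.
Proof. by rewrite /coords mulNmx mxE. Qed.

Lemma coords_inj B x y : B \in unitmx -> coords B x = coords B y -> x = y.
Proof. by move=> uB e; rewrite -(coordsK x uB) e coordsK. Qed.

Lemma height_coords B x : lattice_basis B ->
  x 0 ord0 = \sum_i coords B x 0 i.
Proof.
move=> [uB _ B1]; rewrite -{1}(coordsK x uB) mxE.
by apply: eq_bigr => i _; rewrite B1 mulr1.
Qed.

Lemma finite_coords_bounded B (A : set 'rV[R]_d.+1) (M : R) :
  B \in unitmx -> (forall x, A x -> lattice_point x) ->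
  (forall x, A x -> forall i, `|coords B x 0 i| <= M) -> finite_set A.
Proof.
move=> uB lA AM.
apply: (finite_lattice_bounded (M := \sum_i \sum_j `|M| * `|B i j|)) => //.
move=> x Ax j; rewrite -{1}(coordsK x uB) mxE.
apply: le_trans (ler_norm_sum _ _ _) _; apply: ler_sum => i _.
rewrite (bigD1 j) //= normrM -[leLHS]addr0 lerD //.
  by rewrite ler_wpM2r // (le_trans (AM x Ax i)) // ler_norm.
by apply: sumr_ge0 => k _; rewrite mulr_ge0.
Qed.

Lemma half_open_box_coords B N x : half_open_box B N x ->
  forall i, 0 <= coords B x 0 i <= 1.
Proof.
by move=> [_ bx] i; have := bx i; case: ifP => _; lra.
Qed.

Lemma finite_half_open_box B N : B \in unitmx -> finite_set (half_open_box B N).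
Proof.
move=> uB; apply: (finite_coords_bounded (M := 1) uB) => [x []//|x bx i].
by have /andP[? ?] := half_open_box_coords bx i; rewrite ger0_norm.
Qed.

(** As not every facet is removed, some coordinate is less than 1, so the
height of a box point is less than the number of generators. *)
Lemma half_open_box_height B N x : lattice_basis B -> (exists i, ~~ N i) ->
  half_open_box B N x -> exists2 j : nat, (j < d.+1)%N & x 0 ord0 = j%:R.
Proof.
move=> LB [i0 Ni0] bx; have bx01 := half_open_box_coords bx.
have h0 : 0 <= x 0 ord0.
  by rewrite (height_coords _ LB) sumr_ge0 // => i _; case/andP: (bx01 i).
have lx : x 0 ord0 \is a Num.int by case: bx => + _; apply.
have /natrP[j xj] : x 0 ord0 \is a Num.nat by rewrite natrEint lx.
exists j => //; rewrite -(ltr_nat R) -xj (height_coords _ LB).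
have <- : \sum_(i < d.+1) 1 = d.+1%:R :> R by rewrite sumr_const card_ord.
rewrite [ltLHS](bigD1 i0) // [ltRHS](bigD1 i0) //=.
apply: ltr_leD; last by apply: ler_sum => i _; case/andP: (bx01 i).
by case: bx => _ /(_ i0); rewrite (negbTE Ni0) => /andP[].
Qed.

(** The lattice translates of the half-open box tile: the integer part of a
coordinate is its floor, or its ceiling minus one on the removed facets. *)
Lemma half_open_cone_decomp B N x : lattice_basis B ->
  lattice_point x -> half_open_cone B N x ->
  exists (b : 'rV[R]_d.+1) (v : 'I_d.+1 -> nat),
    half_open_box B N b /\ x = b + (\row_i (v i)%:R) *m B.
Proof.
move=> [uB lB B1] lx Cx.
have vP i : exists v : nat,
    let c := coords B x 0 i - v%:R in if N i then 0 < c <= 1 else 0 <= c < 1.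
  move: (coords B x 0 i) (Cx i) => c; case: ifP => _ ci.
    exists (absz (Num.ceil c - 1)).
    have c0 : 0 <= Num.ceil c - 1 by rewrite subr_ge0 -gtz0_ge1 ceil_gt0.
    rewrite /= natr_absz (ger0_norm c0).
    have := ceil_itv c; rewrite !rmorphB /=; lra.
  exists (Num.truncn c) => /=.
  have := truncn_itv ci; rewrite -natr1; lra.
have {vP} [v vP] := choice vP.
pose w : 'rV[R]_d.+1 := \row_i (v i)%:R.
exists (x - w *m B), v; split; last by rewrite subrK.
split=> [|i].
  apply: lattice_pointB => //; apply: lattice_point_mul => // i.
  by rewrite mxE natr_int.
by rewrite coordsD coordsN coords_mul // [w 0 i]mxE; exact: vP.
Qed.

Lemma half_open_cone_decomp_inj B N (b b' : 'rV[R]_d.+1)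
    (v v' : 'I_d.+1 -> nat) : B \in unitmx ->
  half_open_box B N b -> half_open_box B N b' ->
  b + (\row_i (v i)%:R) *m B = b' + (\row_i (v' i)%:R) *m B ->
  b = b' /\ v =1 v'.
Proof.
move=> uB bb bb' e.
have ei i : coords B b 0 i + (v i)%:R = coords B b' 0 i + (v' i)%:R.
  have := congr1 (fun z => coords B z 0 i) e.
  by rewrite !coordsD !coords_mul // ![(\row__ _) 0 i]mxE.
have vv i : v i = v' i.
  have : `|(v i)%:R - (v' i)%:R : R| < 1.
    have [_ /(_ i)] := bb; have [_ /(_ i)] := bb'; have := ei i.
    by case: ifP => _ ? ? ?; rewrite ltr_norml; lra.
  exact: natr_dist_lt1.
split=> //; apply: (coords_inj uB); apply/rowP => i.
by have := ei i; rewrite vv => /addIr.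
Qed.

Lemma half_open_cone_comp B N (b : 'rV[R]_d.+1) (v : 'I_d.+1 -> nat) :
  lattice_basis B -> half_open_box B N b ->
  let x := b + (\row_i (v i)%:R) *m B in
  [/\ half_open_cone B N x, lattice_point x &
      x 0 ord0 = b 0 ord0 + (\sum_i v i)%:R].
Proof.
move=> LB; have [uB lB B1] := LB; move=> bb x.
have cx i : coords B x 0 i = coords B b 0 i + (v i)%:R.
  by rewrite coordsD coords_mul // [(\row__ _) 0 i]mxE.
split.
- move=> i; rewrite cx; have [_ /(_ i)] := bb.
  by have : 0 <= (v i)%:R :> R by []; case: ifP => _; lra.
- apply: lattice_pointD; first by case: bb.
  by apply: lattice_point_mul => // i; rewrite mxE natr_int.
- rewrite !(height_coords _ LB) natr_sum -big_split /=.
  by apply: eq_bigr => i _; rewrite cx.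
Qed.

(** Grouping the lattice points of height k by their box point b of height j
leaves the compositions of k - j into d + 1 parts. *)
Theorem card_half_open_cone B N (k : nat) : lattice_basis B ->
  (exists i, ~~ N i) ->
  let A := half_open_cone B N `&` lattice_point (d := d.+1) `&` level k in
  finite_set A /\
  #|` fset_set A| = (\sum_(j < d.+1) box_count B N j * 'C(k + d - j, d))%N.
Proof.
move=> LB N0 A; have [uB lB B1] := LB; split.
  apply: (finite_coords_bounded (M := k%:R) uB) => [x [[]]//|x [[Cx _] xk] i].
  have c0 j : 0 <= coords B x 0 j by have := Cx j; case: ifP => _; lra.
  rewrite ger0_norm // -xk (height_coords _ LB) (bigD1 i) //= lerDl.
  by rewrite sumr_ge0.
pose bs (j : nat) : seq 'rV[R]_d.+1 :=
  enum_fset (fset_set (half_open_box B N `&` level j)).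
have bsP j x : x \in bs j <-> half_open_box B N x /\ x 0 ord0 = j%:R.
  by rewrite in_fset_set ?inE //; exact/finite_setIl/finite_half_open_box.
pose cs (n : nat) : seq (d.+1.-tuple 'I_n.+1) :=
  enum [set t : d.+1.-tuple 'I_n.+1 | (\sum_(i <- t) i == n)%N]%SET.
have size_cs n : size (cs n) = 'C(d + n, d).
  by rewrite -cardE card_ord_partitions.
have csP n (t : d.+1.-tuple 'I_n.+1) :
    t \in cs n <-> (\sum_(i < d.+1) tnth t i)%N = n.
  by rewrite mem_enum inE big_tuple; split => [/eqP|/eqP].
pose pt (b : 'rV[R]_d.+1) n (t : d.+1.-tuple 'I_n.+1) : 'rV[R]_d.+1 :=
  b + (\row_i (tnth t i : nat)%:R) *m B.
pose js : seq nat := [seq j <- iota 0 d.+1 | (j <= k)%N].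
pose S (j : nat) : seq 'rV[R]_d.+1 := [seq pt b _ t | b <- bs j,
  t <- cs (k - j)%N].
have SP j x : x \in S j ->
    exists (b : 'rV[R]_d.+1) (t : d.+1.-tuple 'I_(k - j).+1), [/\
    half_open_box B N b, b 0 ord0 = j%:R,
    (\sum_(i < d.+1) tnth t i)%N = (k - j)%N & x = pt b (k - j)%N t].
  by case/allpairsP => -[b t] /= [/bsP[? ?] /csP ? ->]; exists b, t.
have uS j : uniq (S j).
  apply: allpairs_uniq; [exact: fset_uniq|exact: enum_uniq|].
  move=> [b t] [b' t'] /allpairsP[[? ?] /= [/bsP[bb _] _ [-> ->]]].
  move=> /allpairsP[[? ?] /= [/bsP[bb' _] _ [-> ->]]].
  move=> /(half_open_cone_decomp_inj uB bb bb')[-> e].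
  by congr pair; apply: eq_from_tnth => i; apply: val_inj; exact: e.
have -> : #|` fset_set A| = size (flatten [seq S j | j <- js]).
  apply: card_fset_set_uniq.
    apply: uniq_flatten_map => [|j _|j j' x _ _]; last first.
    - move=> /SP[b [t [bb hb _ xe]]] /SP[b' [t' [bb' hb' _ xe']]].
      have [e _] : b = b' /\ (fun i => tnth t i : nat) =1 fun i => tnth t' i.
        by apply: (half_open_cone_decomp_inj uB bb bb'); rewrite -[LHS]xe.
      by apply/eqP; rewrite -(eqr_nat R) -hb -hb' e.
    - exact: uS.
    - by rewrite filter_uniq // iota_uniq.
  move=> x; split.
    move=> /flattenP[y /mapP[j + ->]]; rewrite mem_filter => /andP[jk _].
    move=> /SP[b [t [bb hb tn ->]]].
    have [Cx lx hx] := half_open_cone_comp (fun i => tnth t i) LB bb.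
    by split; [split|rewrite /level /= hx hb tn -natrD subnKC].
  move=> [[Cx lx] xk]; have [b [v [bb xe]]] := half_open_cone_decomp LB lx Cx.
  have [j jd hb] := half_open_box_height LB N0 bb.
  have [_ _] := half_open_cone_comp v LB bb; rewrite -xe xk hb -natrD.
  move=> /eqP; rewrite eqr_nat => /eqP kj.
  have jk : (j <= k)%N by rewrite kj leq_addr.
  have vk : (\sum_i v i)%N = (k - j)%N by rewrite kj addKn.
  apply/flattenP; exists (S j).
    by apply/mapP; exists j => //; rewrite mem_filter jk mem_iota.
  have lt_v i : (v i < (k - j).+1)%N by rewrite ltnS -vk (bigD1 i) //= leq_addr.
  apply/allpairsP; exists (b, [tuple Ordinal (lt_v i) | i < d.+1]) => /=; split.
  - by apply/bsP.
  - by apply/csP; rewrite -[RHS]vk; apply: eq_bigr => i _; rewrite tnth_mktuple.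
  - rewrite xe; congr (_ + _ *m _); apply/rowP => i.
    by rewrite !mxE tnth_mktuple.
rewrite size_flatten /shape -map_comp sumnE big_map big_filter.
rewrite -[iota 0 d.+1]/(index_iota 0 d.+1) big_mkord big_mkcond /=.
apply: eq_bigr => j _; rewrite size_allpairs size_cs /box_count.
case: leqP => jk; first by rewrite addnC addnBAC.
by rewrite [X in (_ * X)%N]bin_small ?muln0 //; have := ltn_ord j; lia.
Qed.

End HalfOpenCone.

(** * Generic vectors and small perturbations *)

Section Generic.
Variable R : realType.

(** Finitely many nonzero vectors define nonzero polynomials, whose roots the
parameter of a point on the moment curve can avoid. *)
Lemma moment_curve_generic n (K : finType) (P : pred K) (u : K -> 'rV[R]_n) :
  (forall k, P k -> u k != 0) ->
  exists t : R, 0 < t /\ forall k, P k -> \sum_i u k 0 i * t ^+ i != 0.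
Proof.
move=> u0; pose p : {poly R} := \prod_(k | P k) rVpoly (u k).
have p0 : p != 0.
  apply/prodf_neq0 => k /u0; apply: contraNN => /eqP uk.
  by rewrite -(rVpolyK (u k)) uk linear0.
pose s : seq R := [seq i.+1%:R | i <- iota 0 (size p)].
have us : uniq s.
  by rewrite map_inj_uniq ?iota_uniq // => i j /eqP; rewrite eqr_nat => /eqP[].
have [t ts pt] : exists2 t, t \in s & ~~ root p t.
  apply/allPn; apply/negP => sp; have := max_poly_roots p0 sp us.
  by rewrite size_map size_iota ltnn.
exists t; split; first by have /mapP[i _ ->] := ts; rewrite ltr0n.
move=> k Pk; have : (rVpoly (u k)).[t] != 0.
  by apply: contraNneq pt => e; rewrite /root horner_prod (bigD1 k) //= e mul0r.
rewrite horner_poly; congr (_ != 0); apply: eq_bigr => i _.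
by rewrite insubT // => lt_i; congr (u k 0 _ * _); apply: val_inj.
Qed.

Lemma near_right0_ex (P : R -> Prop) : (\forall t \near 0^'+, P t) ->
  exists2 t, 0 < t & P t.
Proof.
move=> h; near (0 : R)^'+ => t; exists t; first by near: t;
  exact: nbhs_right_gt.
by near: t.
Unshelve. all: by end_near. Qed.

Lemma near_right0_gt0 (a b : R) : 0 < a \/ (0 <= a /\ 0 < b) ->
  \forall t \near 0^'+, 0 < a + t * b.
Proof.
have b1 : 0 < `|b| + 1 by rewrite ltr_pwDr.
move=> [a0|[a0 b0]]; near=> t.
  have t0 : 0 < t by near: t; exact: nbhs_right_gt.
  have : t < a / (`|b| + 1).
    by near: t; apply: nbhs_right_lt; rewrite divr_gt0.
  rewrite ltr_pdivlMr // => ta.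
  have : - (t * `|b|) <= t * b by rewrite -mulrN ler_pM2l // lerNl
    -normrN ler_norm.
  by move: ta; rewrite mulrDr mulr1; lra.
have t0 : 0 < t by near: t; exact: nbhs_right_gt.
by rewrite ltr_pwDr // mulr_gt0.
Unshelve. all: by end_near. Qed.

Lemma near_right0_neq0 (a b : R) : b != 0 -> \forall t \near 0^'+,
  a + t * b != 0.
Proof.
move=> b0; wlog : a b b0 / 0 < a \/ (0 <= a /\ 0 < b) => [wl|/near_right0_gt0].
  have [ab|ab] := pselect (0 < a \/ (0 <= a /\ 0 < b)); first exact: wl.
  have : \forall t \near 0^'+, - a + t * - b != 0.
    apply: wl; rewrite ?oppr_eq0 // !oppr_gt0 oppr_ge0.
    have [a0|a0|a0] := ltgtP a 0; [by left|by case: ab; left|right].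
    split=> //; have [//|b1|b1] := ltgtP b 0; last by rewrite b1 eqxx in b0.
    by case: ab; right; rewrite a0.
  by apply: filterS => t; rewrite mulrN -opprD oppr_eq0.
by apply: filterS => t; apply: lt0r_neq0.
Qed.

End Generic.

(** * Regular triangulations of a cone *)

Section Triangulation.
Variables (R : realType) (d n : nat) (W : 'M[R]_(n, d.+1)).
Implicit Types (x y z : 'rV[R]_d.+1) (a b : 'rV[R]_n) (S T : {set 'I_n}).

Definition cone : set 'rV[R]_d.+1 :=
  [set x | exists a : 'rV[R]_n, (forall i, 0 <= a 0 i) /\ x = a *m W].

Definition supp a : {set 'I_n} := [set i | a 0 i != 0]%SET.

(** Rows outside S are replaced by zero, so that the spans of all sets of rows
are row spaces of matrices of one type. *)
Definition mask_rows S : 'M[R]_(n, d.+1) :=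
  \matrix_(i, j) (if i \in S then W i j else 0).

(** A vector is generic when it lies in no proper subspace spanned by rows of
the matrix. *)
Definition generic x : Prop :=
  forall S, (x <= mask_rows S)%MS -> row_full (mask_rows S).

Definition row_basis S : bool := (#|S| == d.+1) && row_full (mask_rows S).

(** The matrix that extracts the rows of S, in increasing order; it is only
used for sets of d + 1 elements, where the default value 0 is not reached. *)
Definition selection S : 'M[R]_(d.+1, n) :=
  \matrix_(i < d.+1) nth 0 [seq delta_mx 0 k | k <- enum S] i.

Definition basis_rows S : 'M[R]_d.+1 := selection S *m W.

Lemma supp_mask a S : supp a \subset S -> a *m W = a *m mask_rows S.
Proof.
move=> /fintype.subsetP aS; apply/rowP => j; rewrite !mxE; apply: eq_bigr =>
  i _.
rewrite mxE; case: ifP => // /negbT iS.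
have /eqP -> : a 0 i == 0; last by rewrite !mul0r.
by apply: contraNT iS => ai; apply: aS; rewrite inE.
Qed.

Lemma rank_mask_rows S : (\rank (mask_rows S) <= #|S|)%N.
Proof.
apply: leq_trans (rank_leq_row (rowsub (@enum_val _ (mem S)) W)).
apply: mxrankS; apply/row_subP => i.
have [iS|iS] := boolP (i \in S); last first.
  suff -> : row i (mask_rows S) = 0 by exact: sub0mx.
  by apply/rowP => j; rewrite !mxE (negbTE iS).
suff -> : row i (mask_rows S) =
    row (enum_rank_in iS i) (rowsub (@enum_val _ (mem S)) W) by exact: row_sub.
by apply/rowP => j; rewrite !mxE iS enum_rankK_in.
Qed.

Lemma selectionP S : #|S| = d.+1 ->
  exists s : 'I_d.+1 -> 'I_n, [/\ injective s, forall i, s i \in S,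
    forall k, k \in S -> exists i, k = s i & selection S = rowsub s 1%:M].
Proof.
move=> cS; pose s i := enum_val (cast_ord (esym cS) i); exists s; split.
- by move=> i j /enum_val_inj /cast_ord_inj.
- by move=> i; exact: enum_valP.
- move=> k kS; exists (cast_ord cS (enum_rank_in kS k)).
  by rewrite /s cast_ordK enum_rankK_in.
- apply/row_matrixP => i; rewrite rowK row_rowsub row1.
  have k0 : 'I_n := s ord0.
  rewrite (nth_map k0); last by rewrite -cardE cS.
  by congr delta_mx; rewrite /s (enum_val_nth k0).
Qed.

Lemma row_basis_unit S : row_basis S -> basis_rows S \in unitmx.
Proof.
case/andP => /eqP cS fS; have [s [_ _ sS eS]] := selectionP cS.
rewrite -row_full_unit -sub1mx; apply: submx_trans (_ : (mask_rows S <= _)%MS).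
  by rewrite sub1mx.
apply/row_subP => k; have [kS|kS] := boolP (k \in S); last first.
  suff -> : row k (mask_rows S) = 0 by exact: sub0mx.
  by apply/rowP => j; rewrite !mxE (negbTE kS).
have [i ks] := sS k kS; suff -> : row k (mask_rows S) = row i (basis_rows S).
  exact: row_sub.
rewrite /basis_rows eS mul_rowsub_mx mul1mx row_rowsub -ks.
by apply/rowP => j; rewrite !mxE kS.
Qed.

(** Coordinates in a basis chosen among the rows extend by zero to a
combination of all the rows; conversely a combination supported on the basis
is determined by its value. *)
Lemma basis_coords S : row_basis S ->
  exists s : 'I_d.+1 -> 'I_n,
  [/\ injective s, forall i, s i \in S, forall k, k \in S -> exists i, k = s i,
      forall i, row i (basis_rows S) = row (s i) W &
   [/\ forall x, (coords (basis_rows S) x *m selection S) *m W = x,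
      forall x i,
        (coords (basis_rows S) x *m selection S) 0 (s i) =
        coords (basis_rows S) x 0 i,
      forall x k, k \notin S -> (coords (basis_rows S) x *m selection S) 0 k
        = 0 &
      forall a, supp a \subset S ->
        coords (basis_rows S) (a *m W) *m selection S = a]].
Proof.
move=> bS; have uB := row_basis_unit bS; case/andP: (bS) => /eqP cS _.
have [s [s_inj s_in sS eS]] := selectionP cS; exists s.
have ext v i : (v *m selection S) 0 (s i) = v 0 i.
  rewrite eS mxE (bigD1 i) //= !mxE eqxx mulr1 big1 ?addr0 // => j ji.
  by rewrite !mxE (inj_eq s_inj) (negbTE ji) mulr0.
have ext0 v k : k \notin S -> (v *m selection S) 0 k = 0.
  move=> kS; rewrite eS mxE big1 // => j _; rewrite !mxE.
  by case: eqP => [e|_]; rewrite ?mulr0 //; rewrite -e s_in in kS.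
split=> //; first by move=> i; rewrite /basis_rows eS mul_rowsub_mx mul1mx
  row_rowsub.
split; [by move=> x; rewrite -mulmxA coordsK|by move=> x i; rewrite ext|
  by move=> x k kS; rewrite ext0|].
move=> a /fintype.subsetP aS; pose v : 'rV[R]_d.+1 := \row_i a 0 (s i).
have e : a = v *m selection S.
  apply/rowP => k; have [kS|kS] := boolP (k \in S).
    by have [i ->] := sS k kS; rewrite ext mxE.
  rewrite ext0 //; apply/eqP; apply: contraNT kS => ak; apply: aS.
  by rewrite inE.
by rewrite e -mulmxA coords_mul.
Qed.

Lemma generic_coords S x i : row_basis S -> generic x ->
  coords (basis_rows S) x 0 i != 0.
Proof.
move=> bS gx; have [s [s_inj s_in sS _ [sK ext ext0 _]]] := basis_coords bS.
case/andP: (bS) => /eqP cS _; apply/eqP => xi0.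
suff : row_full (mask_rows (S :\ s i)).
  rewrite /row_full => /eqP e; have := rank_mask_rows (S :\ s i).
  by rewrite e; have := cardsD1 (s i) S; rewrite s_in cS add1n => -[<-];
    rewrite ltnn.
apply: gx; rewrite -(sK x) (@supp_mask _ (S :\ s i)) ?submxMl //.
apply/fintype.subsetP => k; rewrite !inE => xk.
have kS : k \in S by apply: contraNT xk => kS; rewrite ext0.
by rewrite kS andbT; apply: contraNneq xk => ->; rewrite ext xi0.
Qed.

Definition cost (c : 'I_n -> R) a : R := \sum_i a 0 i * c i.

Lemma costD c a b : cost c (a + b) = cost c a + cost c b.
Proof. by rewrite -big_split; apply: eq_bigr => i _; rewrite mxE mulrDl. Qed.

Lemma costZ c t a : cost c (t *: a) = t * cost c a.
Proof. by rewrite mulr_sumr; apply: eq_bigr => i _; rewrite mxE mulrA. Qed.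

Lemma costN c a : cost c (- a) = - cost c a.
Proof. by rewrite -scaleN1r costZ mulN1r. Qed.

Lemma large_support_dependent S : (d.+1 < #|S|)%N ->
  exists u : 'rV[R]_n, [/\ u != 0, supp u \subset S & u *m W = 0].
Proof.
move=> cS; pose E : 'M[R]_(#|S|, n) := rowsub (@enum_val _ (mem S)) 1%:M.
have kN0 : kermx (E *m W) != 0.
  rewrite -mxrank_eq0 mxrank_ker -lt0n subn_gt0.
  exact: leq_ltn_trans (rank_leq_col _) cS.
have /rowV0Pn[v vk v0] := kN0; exists (v *m E).
have uE i : (v *m E) 0 (enum_val i) = v 0 i.
  rewrite mxE (bigD1 i) //= !mxE eqxx mulr1 big1 ?addr0 // => j ji.
  by rewrite !mxE (inj_eq enum_val_inj) (negbTE ji) mulr0.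
split.
- apply: contraNneq v0 => v0; apply/eqP/rowP => i.
  by rewrite -uE v0 !mxE.
- apply/fintype.subsetP => k; rewrite inE; apply: contraNT => kS.
  rewrite mxE big1 // => j _; rewrite !mxE; case: eqP => [e|];
    rewrite ?mulr0 //.
  by rewrite -e enum_valP in kS.
- by rewrite -mulmxA; apply/sub_kermxP.
Qed.

Hypothesis W1 : forall i, W i ord0 = 1.

Lemma kernel_sum0 a : a *m W = 0 -> \sum_i a 0 i = 0.
Proof.
move/rowP/(_ ord0); rewrite !mxE => e; rewrite -[RHS]e.
by apply: eq_bigr => i _; rewrite W1 mulr1.
Qed.

(** As the entries of a kernel vector add up to 0, one of them is negative,
and moving along the vector makes an entry of the support vanish. *)
Lemma shrink_support c a : (forall i, 0 <= a 0 i) -> (d.+1 < #|supp a|)%N ->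
  exists b, [/\ forall i, 0 <= b 0 i, b *m W = a *m W, cost c b <= cost c a &
                (#|supp b| < #|supp a|)%N].
Proof.
move=> a0 /large_support_dependent[u0 [u00 su0 u0W]].
have [u [uN0 su uW cu]] : exists u, [/\ u != 0, supp u \subset supp a,
    u *m W = 0 & cost c u <= 0].
  have [cu|cu] := leP (cost c u0) 0; first by exists u0.
  exists (- u0); rewrite oppr_eq0 mulNmx u0W oppr0 costN oppr_le0 ltW //.
  by split=> //; rewrite (_ : supp _ = supp u0) //; apply/setP => i;
     rewrite !inE mxE oppr_eq0.
have [i0 ui0] : exists i, u 0 i < 0.
  apply/existsP; apply: contraNT uN0; rewrite negb_exists => /forallP up.
  have {}up i : 0 <= u 0 i by rewrite leNgt.
  have /eqP := kernel_sum0 uW; rewrite psumr_eq0 // => /allP u00'.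
  by apply/eqP/rowP => i; rewrite mxE; apply/eqP/u00'; rewrite mem_index_enum.
pose r i := a 0 i / - u 0 i.
case: (@Order.TotalTheory.arg_minP _ _ _ i0 (fun i => u 0 i < 0) r ui0) =>
  k uk rk.
have rk0 : 0 <= r k by rewrite divr_ge0 // oppr_ge0 ltW.
exists (a + r k *: u); split.
- move=> i; rewrite !mxE; have [ui|ui] := ltP (u 0 i) 0; last first.
    by rewrite addr_ge0 // mulr_ge0.
  by have := rk i ui; rewrite {2}/r ler_pdivlMr ?oppr_gt0 // mulrN
    -subr_ge0 opprK.
- by rewrite mulmxDl -scalemxAl uW scaler0 addr0.
- by rewrite costD costZ gerDl mulr_ge0_le0.
- apply: proper_card; apply/properP; split.
    apply/fintype.subsetP => i; rewrite !inE !mxE; apply: contraNN => ai.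
    have /eqP -> : u 0 i == 0; last by rewrite (eqP ai) mulr0 addr0.
    by apply: contraLR ai => ui; have := fintype.subsetP su i; rewrite !inE;
      apply.
  exists k; first by apply: (fintype.subsetP su); rewrite inE lt_eqF.
  by rewrite inE !mxE /r invrN mulrN mulNr divfK ?subrr ?eqxx // lt_eqF.
Qed.

(** Caratheodory's theorem with control of the cost. *)
Lemma reduce_to_basis c a : generic (a *m W) -> (forall i, 0 <= a 0 i) ->
  exists b, [/\ forall i, 0 <= b 0 i, b *m W = a *m W, cost c b <= cost c a &
                row_basis (supp b)].
Proof.
have [m] := ubnP #|supp a|; elim: m a => // m IH a am ga a0.
have [le_a|lt_a] := leqP #|supp a| d.+1.
  exists a; split=> //; have fa : row_full (mask_rows (supp a)).
    by apply: ga; rewrite (supp_mask (subxx _)) submxMl.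
  rewrite /row_basis fa andbT eqn_leq le_a.
  by apply: leq_trans (rank_mask_rows _); rewrite (eqP fa).
have [b [b0 bW cb sb]] := shrink_support c a0 lt_a.
have [||//|b' [b'0 b'W cb' bb']] := IH b; first exact: leq_trans sb _.
  by rewrite bW.
by exists b'; split=> //; rewrite ?b'W //; apply: le_trans cb.
Qed.

(** Cells are the projections of the facets of the lower hull of the points
lifted to the costs c. *)
Definition lower_facet (c : 'I_n -> R) S : Prop :=
  row_basis S /\ exists u : 'cV[R]_d.+1,
    (forall i, i \in S -> (W *m u) i 0 = c i) /\
    (forall j, j \notin S -> (W *m u) j 0 < c j).

(** The functional of a facet underestimates the cost of any combination, and
is exact on those supported on the facet: hence these are the cheapest ones. *)
Lemma lower_facet_cost c S a b :
  (exists u : 'cV[R]_d.+1, (forall i, i \in S -> (W *m u) i 0 = c i) /\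
    (forall j, j \notin S -> (W *m u) j 0 < c j)) ->
  (forall i, 0 <= b 0 i) -> supp a \subset S -> a *m W = b *m W ->
  cost c a <= cost c b ?= iff (supp b \subset S).
Proof.
move=> [u [uS uT]] b0 aS ab.
have val a' : (a' *m W *m u) 0 0 = \sum_i a' 0 i * (W *m u) i 0.
  by rewrite -mulmxA mxE.
have -> : cost c a = \sum_i b 0 i * (W *m u) i 0.
  rewrite -val -ab val; apply: eq_bigr => i _.
  have [iS|iS] := boolP (i \in S); first by rewrite uS.
  have /eqP -> : a 0 i == 0; last by rewrite !mul0r.
  by apply: contraNT iS => ai; apply: (fintype.subsetP aS); rewrite inE.
have term i : b 0 i * (W *m u) i 0 <= b 0 i * c i
  ?= iff ((b 0 i == 0) || (i \in S)).
  have [iS|iS] := boolP (i \in S).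
    by rewrite uS // orbT; apply/leifP.
  rewrite orbF; have := b0 i; rewrite le_eqVlt => /orP[/eqP <-|bi].
    by rewrite !mul0r eqxx; apply/leifP.
  by rewrite gt_eqF //; apply/leifP; rewrite ltr_pM2l ?uT.
suff <- : [forall (i | predT i), (b 0 i == 0) || (i \in S)]
  = (supp b \subset S).
  exact: leif_sum (fun i _ => term i).
apply/idP/idP => [/forallP h|/fintype.subsetP h].
  apply/fintype.subsetP => i; rewrite inE => bi.
  by have := h i; rewrite (negbTE bi).
apply/forallP => i /=; by have [//|bi] := eqVneq (b 0 i) 0; rewrite h // inE.
Qed.

Lemma lower_facet_unique c S T a b : lower_facet c S -> lower_facet c T ->
  (forall i, 0 <= a 0 i) -> (forall i, 0 <= b 0 i) ->
  supp a = S -> supp b = T -> a *m W = b *m W -> S = T.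
Proof.
move=> [bS uS] [bT uT] a0 b0 aS bT' ab.
have sa : supp a \subset S by rewrite aS.
have sb : supp b \subset T by rewrite bT'.
have [le_ab eq_ab] := lower_facet_cost uS b0 sa ab.
have [le_ba eq_ba] := lower_facet_cost uT a0 sb (esym ab).
have e : cost c a = cost c b by apply/eqP; rewrite eq_le le_ab.
apply/eqP; rewrite finset.eqEsubset -{1}aS -{2}bT'.
by rewrite -eq_ba -eq_ab e eqxx.
Qed.

(** The functional that interpolates the cost on a basis prices every row by
the cost of its expansion in this basis. *)
Lemma facet_functional c S : row_basis S -> exists u : 'cV[R]_d.+1,
  (forall i, i \in S -> (W *m u) i 0 = c i) /\
  (forall j, (W *m u) j 0 =
     cost c (coords (basis_rows S) (row j W) *m selection S)).
Proof.
move=> bS; have [s [_ _ _ _ [_ _ _ cK]]] := basis_coords bS.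
pose u : 'cV[R]_d.+1 := invmx (basis_rows S) *m (selection S *m \col_i c i).
have uE j : (W *m u) j 0 = cost c (coords (basis_rows S) (row j W) *m selection
  S).
  transitivity ((row j W *m u) 0 0); first by rewrite -row_mul [RHS]mxE.
  rewrite /u mulmxA mulmxA mxE; apply: eq_bigr => k _.
  by congr (_ * _); rewrite mxE.
exists u; split=> // i iS; rewrite uE rowE cK.
  rewrite /cost (bigD1 i) //= mxE !eqxx mul1r big1 ?addr0 // => k ki.
  by rewrite mxE eqxx (negbTE ki) mul0r.
apply/fintype.subsetP => k; rewrite inE mxE eqxx /=.
by case: (eqVneq k i) => [->|]; rewrite ?eqxx.
Qed.

Definition generic_cost (c : 'I_n -> R) : Prop := forall S j, row_basis S ->
  j \notin S ->
  cost c (delta_mx 0 j - coords (basis_rows S) (row j W) *m selection S) != 0.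

Lemma exists_generic_cost : exists c, generic_cost c.
Proof.
pose u (p : {set 'I_n} * 'I_n) : 'rV[R]_n :=
  delta_mx 0 p.2 - coords (basis_rows p.1) (row p.2 W) *m selection p.1.
have [|t [_ tP]] := @moment_curve_generic R n _
    (fun p => row_basis p.1 && (p.2 \notin p.1)) u.
  move=> [S j] /= /andP[bS jS]; apply/eqP => /rowP/(_ j); apply/eqP.
  have [s [_ _ _ _ [_ _ ext0 _]]] := basis_coords bS.
  rewrite mxE [X in _ + X]mxE ext0 // [_ 0 j]mxE !eqxx oppr0 addr0 mxE.
  exact: oner_neq0.
exists (fun i => t ^+ i) => S j bS jS.
by apply: (tP (S, j)); rewrite /= bS.
Qed.

(** The cheapest basic representation of a generic vector lives on a lower
facet: a row below the facet could enter the support and lower the cost. *)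
Lemma lower_facet_exists c x : generic_cost c -> generic x -> cone x ->
  exists S a, [/\ lower_facet c S, forall i, 0 <= a 0 i,
    supp a = S & x = a *m W].
Proof.
move=> gc gx [a0 [a0_ge0 xa0]].
pose a S := coords (basis_rows S) x *m selection S.
pose F S := row_basis S && [forall i, 0 <= a S 0 i].
have reduce b : (forall i, 0 <= b 0 i) -> x = b *m W ->
    exists2 S, F S & cost c (a S) <= cost c b.
  move=> b0 xb; have [||b' [b'0 b'W cb' bb']] := @reduce_to_basis c b;
    first by rewrite -xb.
    by [].
  have [s [_ _ _ _ [_ _ _ cK]]] := basis_coords bb'.
  have e : a (supp b') = b' by rewrite /a xb -b'W cK.
  by exists (supp b'); rewrite /F ?e // bb'; apply/forallP.
have [S0 FS0 _] := reduce _ a0_ge0 xa0.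
case: (@Order.TotalTheory.arg_minP _ _ _ S0 F (fun S => cost c (a S)) FS0).
move=> S /andP[bS /forallP aS0] Smin.
have [s [s_inj s_in sS _ [sK ext ext0 cK]]] := basis_coords bS.
have suppS : supp (a S) = S.
  apply/setP => k; rewrite inE; have [kS|kS] := boolP (k \in S).
    by have [i ->] := sS k kS; rewrite ext generic_coords.
  by rewrite ext0 // eqxx.
have [u [uS uE]] := facet_functional c bS.
exists S, (a S); split=> //; last by rewrite /a sK.
split=> //; exists u; split=> // j jS; rewrite ltNge; apply/negP => ucj.
(* The kernel vector that brings the row j into the support. *)
pose e : 'rV[R]_n := delta_mx 0 j - coords (basis_rows S) (row j W) *m selection
  S.
have ce : cost c e < 0.
  rewrite lt_neqAle gc //= costD costN -uE subr_le0.
  rewrite /cost (bigD1 j) //= mxE !eqxx mul1r big1 ?addr0 // => k ki.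
  by rewrite mxE eqxx (negbTE ki) mul0r.
have eW : e *m W = 0 by rewrite mulmxBl sK -rowE subrr.
have : \forall t \near 0^'+, forall i, 0 <= a S 0 i + t * e 0 i.
  apply: filter_forall => i; have [iS|iS] := boolP (i \in S).
    have : 0 < a S 0 i by rewrite lt0r aS0 andbT; move: iS;
      rewrite -{1}suppS inE.
    move=> ai; have /near_right0_gt0 := or_introl (0 <= a S 0 i /\ 0
      < e 0 i) ai.
    by apply: filterS => t /ltW.
  have ei : 0 <= e 0 i.
    rewrite mxE [X in _ + X]mxE ext0 // oppr0 addr0 mxE; exact: ler0n.
  have := nbhs_right_gt (0 : R); apply: filterS => t t0.
  by rewrite addr_ge0 // mulr_ge0 // ltW.
move=> /near_right0_ex[t t0 tP].
have [||S' FS' cS'] := reduce (a S + t *: e).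
- by move=> i; rewrite !mxE; have := tP i; rewrite !mxE.
- by rewrite mulmxDl -scalemxAl eW scaler0 addr0 /a sK.
have := le_trans (Smin S' FS') cS'.
by rewrite costD costZ lerDl leNgt pmulr_rlt0 // ce.
Qed.

(** On a line with generic direction each proper subspace is met at most
once. *)
Lemma near_generic x y : generic y -> \forall t \near 0^'+,
  generic (x + t *: y).
Proof.
move=> gy; suff : \forall t \near 0^'+, forall S : {set 'I_n},
    ((x + t *: y)%R <= mask_rows S)%MS -> row_full (mask_rows S).
  by move=> nS; apply: filterS nS => t h S; exact: h.
apply: filter_forall => S; have [fS|fS] := boolP (row_full (mask_rows S)).
  exact: nearW.
have /rV0Pn[j yj] : y *m cokermx (mask_rows S) != 0.
  by apply: contraNN fS => /eqP/eqP yS; apply: gy; rewrite submxE.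
have := near_right0_neq0 ((x *m cokermx (mask_rows S)) 0 j) yj.
apply: filterS => t; rewrite submxE => tj /eqP/rowP/(_ j).
by rewrite mulmxDl -scalemxAl !mxE => /eqP; move: tj; rewrite !mxE => /negPf ->.
Qed.

Lemma exists_generic : row_full W -> exists y, generic y /\ cone y.
Proof.
move=> fW; pose C S := W *m cokermx (mask_rows S).
have [|t [t0 tP]] := @moment_curve_generic R n _
   (fun p : {set 'I_n} * 'I_d.+1 => col p.2 (C p.1) != 0)
   (fun p => (col p.2 (C p.1))^T).
  by move=> [S j] /=; rewrite trmx_eq0.
exists ((\row_i t ^+ i) *m W); split; last first.
  by exists (\row_i t ^+ i); split=> // i; rewrite mxE exprn_ge0 // ltW.
move=> S; rewrite submxE -mulmxA -/(C S) => /eqP yS.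
rewrite -[row_full _]negbK; apply/negP => fS.
have Cj j : col j (C S) = 0.
  apply/eqP; apply/negPn/negP => Cj; have /negP := tP (S, j) Cj; apply.
  move/rowP/(_ j): yS; rewrite mxE [RHS]mxE => e.
  rewrite -[X in _ == X]e; apply/eqP; apply: eq_bigr => i _.
  by rewrite 2!mxE [(\row__ _) _ _]mxE mulrC.
have CS0 : C S = 0.
  by apply/trmx_inj/row_matrixP => j; rewrite -tr_col Cj !trmx0 row0.
have : cokermx (mask_rows S) = 0.
  by have /row_fullP[B BW] := fW; rewrite -[LHS]mul1mx -BW -mulmxA
    -/(C S) CS0 mulmx0.
move/eqP; rewrite -mxrank_eq0 mxrank_coker subn_eq0 => h.
by move: fS; rewrite /row_full eqn_leq rank_leq_col h.
Qed.

(** These are the facets through which a small step in the direction y leaves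
the cell of S; a facet is designated by the opposite generator. *)
Definition visible y S : pred 'I_d.+1 := fun i =>
  coords (basis_rows S) y 0 i < 0.

Lemma half_open_near x y S : (forall i, coords (basis_rows S) y 0 i != 0) ->
  half_open_cone (basis_rows S) (visible y S) x ->
  \forall t \near 0^'+, forall i, 0 < coords (basis_rows S) (x + t *: y) 0 i.
Proof.
move=> yn0 Cx; apply: filter_forall => i.
have : 0 < coords (basis_rows S) x 0 i \/
    (0 <= coords (basis_rows S) x 0 i /\ 0 < coords (basis_rows S) y 0 i).
  have := Cx i; rewrite /visible; case: ifP => yi ci; first by left.
  by right; split=> //; rewrite lt_neqAle eq_sym yn0 leNgt yi.
by move/near_right0_gt0; apply: filterS => t; rewrite coordsD coordsZ.
Qed.

Lemma not_half_open_near x y S :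
  ~ half_open_cone (basis_rows S) (visible y S) x ->
  \forall t \near 0^'+, ~ forall i, 0 < coords (basis_rows S) (x + t *: y) 0 i.
Proof.
move=> /existsNP[i]; rewrite /visible; set b := coords _ y 0 i.
set a := coords _ x 0 i => nab.
suff : \forall t \near 0^'+, 0 < - a + t * - b.
  apply: filterS => t + /(_ i); rewrite coordsD coordsZ -/a -/b mulrN; lra.
apply: near_right0_gt0; move: nab; case: ifP => b0 /negP.
  by rewrite -leNgt => a0; right; rewrite oppr_ge0 oppr_gt0.
by rewrite -ltNge => a0; left; rewrite oppr_gt0.
Qed.

Lemma coords_ge0_cone x S : row_basis S ->
  (forall i, 0 <= coords (basis_rows S) x 0 i) -> cone x.
Proof.
move=> bS x0; have [s [_ _ sS _ [sK ext ext0 _]]] := basis_coords bS.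
exists (coords (basis_rows S) x *m selection S); rewrite sK; split=> // k.
have [kS|kS] := boolP (k \in S); last by rewrite ext0.
by have [i ->] := sS k kS; rewrite ext.
Qed.

Lemma half_open_cone_sub x S N : row_basis S ->
  half_open_cone (basis_rows S) N x -> cone x.
Proof.
move=> bS Cx; apply: (coords_ge0_cone bS) => i.
by have := Cx i; case: ifP => // _ /ltW.
Qed.

Lemma coneD x y t : cone x -> cone y -> 0 <= t -> cone (x + t *: y).
Proof.
move=> [a [a0 ->]] [b [b0 ->]] t0; exists (a + t *: b).
by rewrite mulmxDl scalemxAl; split=> // i; rewrite !mxE addr_ge0 // mulr_ge0.
Qed.

(** A cone is the disjoint union of half-open simplicial cones: a vector
belongs to the cell that contains it after a small shift in a generic
direction y. Disjointness also holds for other directions, in particular for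
the opposite one. *)
Definition half_open_partition (T : {set {set 'I_n}}) y : Prop :=
  [/\ forall S, S \in T -> row_basis S, generic y, cone y,
      (forall x, cone x ->
         exists2 S, S \in T & half_open_cone (basis_rows S) (visible y S) x) &
      (forall z x S S', S \in T -> S' \in T ->
         (forall S i, S \in T -> coords (basis_rows S) z 0 i != 0) ->
         half_open_cone (basis_rows S) (visible z S) x ->
         half_open_cone (basis_rows S') (visible z S') x -> S = S')].

Theorem exists_half_open_partition : row_full W ->
  exists (T : {set {set 'I_n}}) y, half_open_partition T y.
Proof.
move=> fW; have [c gc] := exists_generic_cost; have [y [gy Cy]] :=
  exists_generic fW.
pose T := [set S : {set 'I_n} | `[< lower_facet c S >]]%SET.
have TP S : S \in T -> lower_facet c S by rewrite inE => /asboolP.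
exists T, y; split=> //.
- by move=> S /TP[].
- move=> x Cx; have [//|no] := pselect (exists2 S, S \in T &
      half_open_cone (basis_rows S) (visible y S) x).
  (* Otherwise, for small t, the vector x + t y would be interior to no cell. *)
  have noT : \forall t \near 0^'+, forall S : {set 'I_n}, S \in T ->
      ~ forall i, 0 < coords (basis_rows S) (x + t *: y) 0 i.
    apply: filter_forall => S; have [ST|ST] := boolP (S \in T).
      have : ~ half_open_cone (basis_rows S) (visible y S) x.
        by move=> CS; apply: no; exists S.
      by move=> /not_half_open_near; apply: filterS.
    exact: nearW.
  have [t t0 [gt nt]] := near_right0_ex (filterI (near_generic x gy) noT).
  have [S [a [fS a0 sS xa]]] :=
    lower_facet_exists gc gt (coneD Cx Cy (ltW t0)).
  have ST : S \in T by rewrite inE; apply/asboolP.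
  have bS := fS.1; have [s [_ s_in _ _ [_ ext _ cK]]] := basis_coords bS.
  case: (nt S ST) => i; rewrite -ext xa cK ?sS // lt0r a0 andbT.
  by have := s_in i; rewrite -{1}sS inE.
- move=> z x S S' ST S'T zn0 CS CS'.
  have [||t _ [pS pS']] := near_right0_ex (filterI (half_open_near _ CS)
    (half_open_near _ CS')).
  + by move=> i; apply: zn0.
  + by move=> i; apply: zn0.
  have repr S0 : S0 \in T -> (forall i, 0 < coords (basis_rows S0) (x + t
    *: z) 0 i) ->
      exists a, [/\ forall i, 0 <= a 0 i, supp a = S0 & x + t *: z = a *m W].
    move=> /TP[bS0 _] p0; have [s [_ s_in sS _ [sK ext ext0 cK]]] :=
      basis_coords bS0.
    exists (coords (basis_rows S0) (x + t *: z) *m selection S0).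
    rewrite sK; split=> //.
      move=> k; have [/sS[i ->]|kS] := boolP (k \in S0); last by rewrite ext0.
      by rewrite ext ltW.
    apply/setP => k; rewrite inE; have [/sS[i ->]|kS] := boolP (k \in S0).
      by rewrite ext gt_eqF.
    by rewrite ext0 // eqxx.
  have [a [a0 sa ea]] := repr S ST pS; have [b [b0 sb eb]] := repr S' S'T pS'.
  by apply: lower_facet_unique (TP _ ST) (TP _ S'T) a0 b0 sa sb _; rewrite -ea.
Qed.

End Triangulation.

(** * Ehrhart's theorem *)

Section Homogenization.
Variables (R : realType) (d : nat).
Implicit Types (x y : 'rV[R]_d) (z : 'rV[R]_d.+1) (r t : R).

Definition homog r x : 'rV[R]_d.+1 :=
  \row_j (if unlift ord0 j is Some i then x 0 i else r).

Definition tail z : 'rV[R]_d := \row_i z 0 (lift ord0 i).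

Lemma homog0E r x : homog r x 0 ord0 = r.
Proof. by rewrite mxE unlift_none. Qed.

Lemma homogSE r x i : homog r x 0 (lift ord0 i) = x 0 i.
Proof. by rewrite mxE liftK. Qed.

Lemma homogK r x : tail (homog r x) = x.
Proof. by apply/rowP => i; rewrite mxE homogSE. Qed.

Lemma tailK z : homog (z 0 ord0) (tail z) = z.
Proof.
by apply/rowP => j; case: (unliftP ord0 j) => [i|] ->;
  rewrite ?homogSE ?homog0E ?mxE.
Qed.

Lemma homogD r s x y : homog (r + s) (x + y) = homog r x + homog s y.
Proof.
by apply/rowP => j; rewrite !mxE; case: unlift => [i|] //; rewrite mxE.
Qed.

Lemma homogZ t r x : homog (t * r) (t *: x) = t *: homog r x.
Proof.
by apply/rowP => j; rewrite !mxE; case: unlift => [i|] //; rewrite mxE.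
Qed.

Lemma homog_inj r s x y : homog r x = homog s y -> r = s /\ x = y.
Proof.
by move=> e; rewrite -(homogK r x) e homogK; split=> //;
  rewrite -(homog0E r x) e homog0E.
Qed.

Lemma homog_sum n (r : 'I_n -> R) (x : 'I_n -> 'rV[R]_d) :
  homog (\sum_i r i) (\sum_i x i) = \sum_i homog (r i) (x i).
Proof.
apply/rowP => j; rewrite summxE; case: (unliftP ord0 j) => [i|] ->.
  by rewrite homogSE summxE; apply: eq_bigr => k _; rewrite homogSE.
by rewrite homog0E; apply: eq_bigr => k _; rewrite homog0E.
Qed.

Lemma lattice_point_homog (k : nat) x :
  lattice_point (homog k%:R x) <-> lattice_point x.
Proof.
split=> lx => [i|j]; first by rewrite -(homogSE k%:R x i); exact: lx.
by case: (unliftP ord0 j) => [i|] ->; rewrite ?homogSE ?homog0E ?natr_int.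
Qed.

Definition homog_rows n (V : 'I_n -> 'rV[R]_d) : 'M[R]_(n, d.+1) :=
  \matrix_i homog 1 (V i).

Variables (n : nat) (V : 'I_n -> 'rV[R]_d).
Let W := homog_rows V.
Let P := convex_hull V.

Lemma homog_rows1 i : W i ord0 = 1.
Proof. by rewrite mxE homog0E. Qed.

Lemma mul_homog_rows (a : 'rV[R]_n) :
  a *m W = homog (\sum_i a 0 i) (\sum_i a 0 i *: V i).
Proof.
rewrite homog_sum mulmx_sum_row; apply: eq_bigr => i _.
by rewrite rowK -homogZ mulr1.
Qed.

Lemma cone_homog r x : 0 < r -> cone W (homog r x) <-> P (r^-1 *: x).
Proof.
move=> r0; split=> [[a [a0]]|[a [a0 a1 e]]].
  rewrite mul_homog_rows => /homog_inj[er ex].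
  exists (fun i => r^-1 * a 0 i); split.
  - by move=> i; rewrite mulr_ge0 // invr_ge0 ltW.
  - by rewrite -mulr_sumr -er mulVf // gt_eqF.
  - by rewrite ex scaler_sumr; apply: eq_bigr => i _; rewrite scalerA.
exists (\row_i (r * a i)); split; first by move=> i;
  rewrite mxE mulr_ge0 // ltW.
rewrite mul_homog_rows; congr homog.
  by rewrite -[LHS]mulr1 -a1 mulr_sumr; apply: eq_bigr => i _; rewrite mxE.
rewrite -[LHS]scale1r -(divff (lt0r_neq0 r0)) -scalerA e scaler_sumr.
by apply: eq_bigr => i _; rewrite mxE scalerA.
Qed.

Hypothesis n_gt0 : (0 < n)%N.

Lemma convex_hull_vertex i : P (V i).
Proof.
exists (fun j => (j == i)%:R); split; first by move=> j; rewrite ler0n.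
  by rewrite (bigD1 i) //= eqxx big1 ?addr0 // => j /negPf ->.
rewrite (bigD1 i) //= eqxx scale1r big1 ?addr0 // => j /negPf ->.
by rewrite scale0r.
Qed.

Lemma cone_dilate (k : nat) x : cone W (homog k%:R x) <-> dilate k P x.
Proof.
have [->|k0] := posnP k; last first.
  have k0' : 0 < k%:R :> R by rewrite ltr0n.
  rewrite cone_homog //; split=> [Px|[y Py <-]].
    by exists (k%:R^-1 *: x) => //; rewrite scalerA divff ?scale1r ?gt_eqF.
  by rewrite scalerA mulVf ?scale1r ?gt_eqF.
split=> [[a [a0]]|[y Py <-]]; last first.
  exists 0; split; first by move=> i; rewrite mxE.
  by rewrite mul0mx scale0r -[X in homog X](mul0r 1)
    -[X in homog _ X](scale0r y) homogZ scale0r.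
rewrite mul_homog_rows => /homog_inj[/esym/eqP + ->].
rewrite psumr_eq0 // => /allP a00.
exists (V (Ordinal n_gt0)); first exact: convex_hull_vertex.
rewrite scale0r big1 // => i _.
by have /eqP -> := a00 i (mem_index_enum _); rewrite scale0r.
Qed.

Lemma lattice_count_dilate (k : nat) :
  finite_set (cone W `&` lattice_point (d := d.+1) `&` @level R d k) ->
  lattice_count (dilate k P) =
  #|` fset_set (cone W `&` lattice_point (d := d.+1) `&` @level R d k)|.
Proof.
move=> /fset_set_enum[s [us sP <-]]; rewrite -(size_map tail).
apply: card_fset_set_uniq.
  rewrite map_inj_in_uniq // => z z' /sP[_ hz] /sP[_ hz'] e.
  by rewrite -(tailK z) -(tailK z') hz hz' e.
move=> x; split=> [/mapP[z /sP[[Cz lz] hz] ->]|[Px lx]].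
  split; first by apply/cone_dilate; rewrite -hz tailK.
  by apply/(lattice_point_homog k); rewrite -hz tailK.
apply/mapP; exists (homog k%:R x); last by rewrite homogK.
by apply/sP; split; [split; [apply/cone_dilate|apply/lattice_point_homog]|exact:
  homog0E].
Qed.

End Homogenization.

Section Ehrhart.
Variables (R : realType) (d n : nat) (V : 'I_n -> 'rV[R]_d).
Let W := homog_rows V.
Let P := convex_hull V.
Hypothesis V_lattice : forall i, lattice_point (V i).
Hypothesis W_full : row_full W.

Lemma basis_lattice S : row_basis W S -> lattice_basis (basis_rows W S).
Proof.
move=> bS; have [s [_ _ _ rowE _]] := basis_coords bS.
split; first exact: row_basis_unit.
  by move=> i; rewrite rowE rowK; apply/(lattice_point_homog 1).
move=> i; transitivity (row i (basis_rows W S) 0 ord0);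
  first by rewrite [RHS]mxE.
by rewrite rowE mxE homog_rows1.
Qed.

Lemma row_full_gt0 : (0 < n)%N.
Proof. by rewrite (leq_trans _ (rank_leq_row W)) // (eqP W_full). Qed.

Lemma cone_height_ge0 z : cone W z -> 0 <= z 0 ord0.
Proof. by move=> [a [a0 ->]]; rewrite mul_homog_rows homog0E sumr_ge0. Qed.

(** A vector of the cone has nonnegative height, so its coordinates in a cell
are not all negative. *)
Lemma visible_notall S y : row_basis W S -> generic W y -> cone W y ->
  exists i, ~~ visible W y S i.
Proof.
move=> bS gy /cone_height_ge0; rewrite (height_coords _ (basis_lattice bS)) =>
  y0.
apply/existsP; apply: contraTT y0; rewrite negb_exists => /forallP neg.
have {}neg i : coords (basis_rows W S) y 0 i < 0 by have := neg i;
  rewrite negbK.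
rewrite -ltNge big_ord_recl; apply: ltr_wnDr; last exact: neg.
by apply: sumr_le0 => i _; apply: ltW.
Qed.

Definition hstar (T : {set {set 'I_n}}) y (j : nat) : nat :=
  (\sum_(S in T) box_count (basis_rows W S) (visible W y S) j)%N.

Lemma card_cone_level T y k : half_open_partition W T y ->
  let A := cone W `&` lattice_point (d := d.+1) `&` @level R d k in
  finite_set A /\
  #|` fset_set A| = (\sum_(j < d.+1) hstar T y j * 'C(k + d - j, d))%N.
Proof.
move=> [Tb gy Cy cov dis] A.
pose F S := half_open_cone (basis_rows W S) (visible W y S) `&`
            lattice_point (d := d.+1) `&` @level R d k.
have cardF S : S \in T -> finite_set (F S) /\ #|` fset_set (F S)| =
    (\sum_(j < d.+1) box_count (basis_rows W S) (visible W y S) j *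
       'C(k + d - j, d))%N.
  move=> /Tb bS; apply: card_half_open_cone; first exact: basis_lattice.
  exact: visible_notall.
have [|||fA ->] := @card_fset_set_partition _ _ T A F.
- move=> x; split=> [[[/cov[S ST CS] lx] hx]|[S ST [[CS lx] hx]]].
    by exists S.
  by split=> //; split=> //; apply: half_open_cone_sub CS; exact: Tb.
- move=> S S' x ST S'T [[CS _] _] [[CS' _] _]; apply: (dis y x) => // S0 i S0T.
  by apply: generic_coords => //; exact: Tb.
- by move=> S /cardF[].
split=> //; rewrite (eq_bigr _ (fun S ST => (cardF S ST).2)) exchange_big /=.
by apply: eq_bigr => j _; rewrite big_distrl.
Qed.

Lemma cone_height0 z : cone W z -> z 0 ord0 = 0 -> z = 0.
Proof.
move=> [a [a0 ->]]; rewrite mul_homog_rows homog0E => /eqP.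
rewrite psumr_eq0 // => /allP a00.
have -> : a = 0.
  apply/rowP => i; rewrite mxE; apply/eqP/a00; exact: mem_index_enum.
rewrite big1 => [|i _]; last by rewrite mxE.
rewrite big1 => [|i _]; last by rewrite mxE scale0r.
by apply/rowP => j; rewrite !mxE; case: unlift => [i|] //; rewrite mxE.
Qed.

(** A vertex would be an interior point of a segment towards the generic
direction. *)
Lemma vertex_not_opposite T y S S0 k : (0 < d)%N -> half_open_partition W T y ->
  S \in T -> S0 \in T -> k \in S0 -> vertex P (V k) ->
  ~ half_open_cone (basis_rows W S) (visible W (- y) S) (row k W).
Proof.
move=> d0 [Tb gy Cy _ _] ST S0T kS0 [_ Vk] CS.
have y0 : 0 < y 0 ord0.
  rewrite lt0r cone_height_ge0 // andbT; apply/eqP => /(cone_height0 Cy) y0.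
  have := generic_coords ord0 (Tb S0 S0T) gy.
  by rewrite y0 /coords mul0mx mxE eqxx.
have N0 i : coords (basis_rows W S) (- y) 0 i != 0.
  by rewrite coordsN oppr_eq0; apply: generic_coords => //; exact: Tb.
have lt_y : (0 : R) < (y 0 ord0)^-1 by rewrite invr_gt0.
(* The step t is so small that the shifted vector keeps a positive height. *)
have [t t0 [pt ty]] :=
  near_right0_ex (filterI (half_open_near N0 CS) (nbhs_right_lt lt_y)).
set z := row k W + t *: - y in pt.
have Cz : cone W z by apply: (coords_ge0_cone (Tb S ST)) => i; exact: ltW.
have ty1 : t * y 0 ord0 < 1 by rewrite -ltr_pdivlMr // div1r.
have rk : row k W = homog 1 (V k) by rewrite rowK.
have hz : z 0 ord0 = 1 - t * y 0 ord0.
  by rewrite !mxE unlift_none mulrN.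
have z0 : 0 < z 0 ord0 by rewrite hz subr_gt0.
have PE w : cone W w -> 0 < w 0 ord0 -> P ((w 0 ord0)^-1 *: tail w).
  by move=> Cw w0; apply/cone_homog; rewrite ?tailK.
have [||_ qV] := Vk _ _ (1 - t * y 0 ord0) (PE z Cz z0) (PE y Cy y0).
- by rewrite -hz z0 hz gtrBl mulr_gt0.
- rewrite -{1}hz scalerA divff ?gt_eqF // scale1r subKr.
  rewrite scalerA -mulrA divff ?gt_eqF // mulr1.
  apply/rowP => i; have := congr1 (fun w : 'rV[R]_d.+1 => w 0 (lift ord0 i)) rk.
  rewrite homogSE => <-; rewrite !mxE; lra.
have ye : y = y 0 ord0 *: row k W.
  rewrite rk -homogZ mulr1 -qV scalerA divff ?gt_eqF // scale1r tailK //.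
have [s [s_inj s_in sS rowE [_ ext ext0 cK]]] := basis_coords (Tb S0 S0T).
have [i ki] := sS k kS0.
have [j ji] : exists j : 'I_d.+1, j != i.
  have [->|i0] := eqVneq i ord0; last by exists ord0; rewrite eq_sym.
  by exists (Ordinal (d0 : (1 < d.+1)%N)).
have := generic_coords j (Tb S0 S0T) gy; rewrite ye coordsZ.
have -> : row k W = delta_mx 0 i *m basis_rows W S0
  by rewrite -matrix.rowE rowE ki.
by rewrite coords_mul ?(row_basis_unit (Tb S0 S0T))
  // mxE (negPf ji) andbF mulr0 eqxx.
Qed.

(** The dilate by 0 contains the origin only. *)
Lemma hstar0 T y : half_open_partition W T y -> hstar T y 0 = 1%N.
Proof.
move=> Ty; have [fA cA] := card_cone_level 0 Ty.
have : (\sum_(j < d.+1) hstar T y j * 'C(0 + d - j, d))%N = hstar T y 0.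
  rewrite big_ord_recl /= subn0 binn muln1 big1 ?addn0 // => j _.
  by rewrite [X in (_ * X)%N]bin_small ?muln0 // /bump /=; have := ltn_ord j;
    lia.
rewrite -cA => <-.
apply: (@card_fset_set_uniq _ _ [:: 0]) => // z; rewrite inE; split.
  move=> /eqP ->; split; [split|by rewrite /level /= mxE].
    by exists 0; rewrite mul0mx; split=> // i; rewrite mxE.
  by move=> i; rewrite mxE rpred0.
by move=> [[Cz _] /(cone_height0 Cz) ->].
Qed.

(** Subtracting a box point from the sum of the generators of its cell turns
height d into height 1 and the direction y into its opposite. *)
Lemma half_open_box_opposite T y S b : half_open_partition W T y -> S \in T ->
  (half_open_box (basis_rows W S) (visible W y S) `&` @level R d d) b ->
  let b' := const_mx 1 *m basis_rows W S - b in
  (lattice_point (d := d.+1) `&` @level R d 1) b' /\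
  half_open_cone (basis_rows W S) (visible W (- y) S) b'.
Proof.
move=> [Tb gy Cy _ _] ST [[lb bb] hb] b'.
have LB := basis_lattice (Tb S ST); have [uB lB B1] := LB.
have cb' i : coords (basis_rows W S) b' 0 i = 1 - coords (basis_rows W S) b 0 i.
  by rewrite coordsD coordsN coords_mul // mxE.
split; first split.
- apply: lattice_pointB lb; apply: lattice_point_mul => // i.
  by rewrite mxE int_num1.
- rewrite /level /= (height_coords _ LB) (eq_bigr _ (fun i _ => cb' i)).
  by rewrite sumrB sumr_const card_ord -(height_coords _ LB) hb -natrB
    // subSnn.
- move=> i; have := bb i; rewrite /visible coordsN cb' oppr_lt0.
  have := generic_coords i (Tb S ST) gy.
  by case: ltgtP => // yi _; lra.
Qed.

(** The opposites of the box points of height d are lattice points of the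
polytope. Together with the d + 1 vertices of one cell, which are not of this
kind, they number at most d + 1 + h 1, the number of lattice points of the
polytope. *)
Lemma hstar_last T y : (0 < d)%N -> half_open_partition W T y ->
  (forall i, vertex P (V i)) -> (hstar T y d <= hstar T y 1)%N.
Proof.
move=> d0 Ty Vv; have [Tb gy Cy cov dis] := Ty.
have [fA cA] := card_cone_level 1 Ty.
have : (\sum_(j < d.+1) hstar T y j * 'C(1 + d - j,
  d))%N = (d.+1 + hstar T y 1)%N.
  rewrite big_ord_recl /= subn0 add1n binSn (hstar0 Ty) mul1n; congr addn.
  case: {+}d d0 (hstar T y) => // d' _ h.
  rewrite big_ord_recl /= subSS subn0 binn muln1 big1 ?addn0 // => j _.
  by rewrite [X in (_ * X)%N]bin_small ?muln0 // /bump /=; have := ltn_ord j;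
    lia.
rewrite -cA => eA; rewrite -(leq_add2l d.+1) -eA.
pose B S := enum_fset (fset_set (half_open_box (basis_rows W S) (visible W y S)
  `&` @level R d d)).
have BP S b : S \in T -> b \in B S <->
    (half_open_box (basis_rows W S) (visible W y S) `&` @level R d d) b.
  move=> ST; rewrite in_fset_set ?inE //;
    apply/finite_setIl/finite_half_open_box.
  exact/row_basis_unit/Tb.
pose opp S (b : 'rV[R]_d.+1) := const_mx 1 *m basis_rows W S - b.
pose L := flatten [seq [seq opp U b | b <- B U] | U <- enum T].
have LP x : x \in L -> exists S b, [/\ S \in T, b \in B S & x = opp S b].
  move=> /flattenP[l /mapP[S ST ->]] /mapP[b bB ->]; exists S, b.
  by rewrite mem_enum in ST.
have LC x : x \in L -> (lattice_point (d := d.+1) `&` @level R d 1) x /\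
    exists2 S, S \in T & half_open_cone (basis_rows W S) (visible W (- y) S) x.
  move=> /LP[S [b [ST /(BP _ _ ST) bB ->]]].
  have [? ?] := half_open_box_opposite Ty ST bB; split=> //; by exists S.
have size_L : size L = hstar T y d.
  rewrite size_flatten /shape -map_comp sumnE big_map big_enum /=.
  by apply: eq_bigr => S _; rewrite /= size_map.
have uL : uniq L.
  apply: uniq_flatten_map; first exact: enum_uniq.
    move=> S _; rewrite map_inj_uniq ?fset_uniq // => b b' /addrI /oppr_inj //.
  move=> S S' x; rewrite !mem_enum => ST S'T /mapP[b /(BP _ _ ST) bB ->].
  move=> /mapP[b' /(BP _ _ S'T) bB' e].
  have [_ C] := half_open_box_opposite Ty ST bB.
  have [_ C'] := half_open_box_opposite Ty S'T bB'.
  apply: (dis (- y) _ _ _ ST S'T _ C); last by rewrite -/(opp S b) e.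
  by move=> S0 i S0T; rewrite coordsN oppr_eq0 generic_coords //; exact: Tb.
have [S0 S0T _] := cov y Cy.
pose rows := [seq row k W | k <- enum S0].
have cS0 : #|S0| = d.+1 by case/andP: (Tb S0 S0T) => /eqP.
have rowsN x : x \in rows -> x \notin L.
  move=> /mapP[k]; rewrite mem_enum => kS0 ->; apply/negP => /LC[_ [S ST CS]].
  exact: (vertex_not_opposite d0 Ty ST S0T kS0).
have urows : uniq rows.
  have [s [s_inj s_in sS rowE _]] := basis_coords (Tb S0 S0T).
  rewrite map_inj_in_uniq ?enum_uniq // => k k'; rewrite !mem_enum.
  move=> /sS[i ->] /sS[j ->]; rewrite -!rowE => e.
  have := congr1 (fun v => coords (basis_rows W S0) v) e.
  rewrite !matrix.rowE !coords_mul ?(row_basis_unit (Tb S0 S0T)) //.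
  move=> /rowP/(_ i)/eqP; rewrite !mxE !eqxx /=; case: (eqVneq i j) =>
    [->|] //= _.
  by rewrite oner_eq0.
have uLr : uniq (rows ++ L).
  rewrite cat_uniq urows uL andbT; apply/hasPn => x xL.
  by apply: contraL xL; exact: rowsN.
have [s [us sP <-]] := fset_set_enum fA.
have -> : (d.+1 + hstar T y d)%N = size (rows ++ L).
  by rewrite size_cat size_L size_map -cardE cS0.
apply: uniq_leq_size => // x; rewrite mem_cat => /orP[xr|xL]; apply/sP.
  have /mapP[k _ ->] := xr; split; [split|].
  - exists (delta_mx 0 k); rewrite -matrix.rowE; split=> // i.
    by rewrite mxE; case: (_ && _).
  - by rewrite rowK; apply/(lattice_point_homog 1).
  - by rewrite /level /= mxE homog_rows1.
have [[lx hx] [S ST CS]] := LC x xL.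
split=> //; split=> //; apply: half_open_cone_sub CS; exact: Tb.
Qed.

(** The numbers h j are the coefficients of the numerator of the Ehrhart series;
being cardinalities of sets of box points they are nonnegative. *)
Theorem ehrhart_hstar : (0 < d)%N -> exists h : nat -> nat,
  [/\ forall k, lattice_count (dilate k P) =
        (\sum_(j < d.+1) h j * 'C(k + d - j, d))%N,
      h 0%N = 1%N &
      (forall i, vertex P (V i)) -> (h d <= h 1%N)%N].
Proof.
move=> d0; have [T [y Ty]] := exists_half_open_partition (homog_rows1 V) W_full.
exists (hstar T y); split; last exact: hstar_last.
  move=> k; have [fA cA] := card_cone_level k Ty.
  by rewrite lattice_count_dilate ?row_full_gt0.
exact: hstar0.
Qed.

End Ehrhart.

(** * The volume is the leading coefficient *)

Section PolyLimit.
Variable R : realType.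

Lemma horner0_ge0 (q : {poly R}) :
  (forall k : nat, (0 < k)%N -> 0 <= q.[k%:R^-1]) -> 0 <= q.[0].
Proof.
move=> qk; rewrite leNgt; apply/negP => q0.
have : \forall n \near \oo, q.[harmonic n] < 0.
  have qc := @continuous_horner R q 0.
  exact: (cvgr_lt _ (cvg_comp _ _ (@cvg_harmonic R) qc)).
case=> N _ /(_ N (leqnn N)) /=; apply/negP; rewrite -leNgt.
exact: qk.
Qed.

Lemma horner0_le (p q : {poly R}) :
  (forall k : nat, (0 < k)%N -> p.[k%:R^-1] <= q.[k%:R^-1]) -> p.[0] <= q.[0].
Proof.
move=> pq; rewrite -subr_ge0 -hornerN -hornerD; apply: horner0_ge0 => k k0.
by rewrite hornerD hornerN subr_ge0 pq.
Qed.

Lemma natr_ffact (n m : nat) :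
  (n ^_ m)%:R = \prod_(i < m) (n%:R - i%:R) :> R.
Proof.
elim: m => [|m IH]; first by rewrite big_ord0.
rewrite big_ord_recr /= -IH ffactnSr natrM; have [mn|nm] := leqP m n.
  by rewrite natrB.
by rewrite ffact_small // !mul0r.
Qed.

Lemma natr_bin (n m : nat) :
  'C(n, m)%:R = m`!%:R^-1 * \prod_(i < m) (n%:R - i%:R) :> R.
Proof.
by rewrite -natr_ffact -bin_ffact natrM mulrCA mulVf ?mulr1.
Qed.

(** The polynomial in 1/k whose product with k^d is the number of lattice
points of the dilate by k + N. *)
Definition scaled_count d (h : nat -> nat) (N : nat) : {poly R} :=
  \sum_(j < d.+1) ((h j)%:R / d`!%:R) *:
    \prod_(l < d) (1 + ((N + d - j)%:R - l%:R) *: 'X).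

Lemma scaled_count0 d (h : nat -> nat) N :
  (scaled_count d h N).[0] = (\sum_(j < d.+1) h j)%:R / d`!%:R.
Proof.
rewrite /scaled_count horner_sum natr_sum mulr_suml; apply: eq_bigr => j _.
rewrite hornerZ horner_prod big1 ?mulr1 // => l _.
by rewrite !hornerE ?mulr0 ?addr0.
Qed.

Lemma scaled_countE d (h : nat -> nat) N k : (0 < k)%N ->
  (\sum_(j < d.+1) h j * 'C((k + N) + d - j, d))%:R =
  k%:R ^+ d * (scaled_count d h N).[k%:R^-1] :> R.
Proof.
move=> k0; have k0' : k%:R != 0 :> R by rewrite pnatr_eq0 -lt0n.
rewrite /scaled_count horner_sum natr_sum mulr_sumr; apply: eq_bigr => j _.
rewrite hornerZ mulrCA natrM natr_bin [LHS]mulrA; congr (_ * _).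
rewrite horner_prod -[X in _ ^+ X]card_ord -prodr_const -big_split /=.
apply: eq_bigr => l _; rewrite !hornerE mulrDr mulr1 mulrCA mulfV // mulr1.
by rewrite addrA -natrD; congr (_%:R - _); have := ltn_ord j; lia.
Qed.

End PolyLimit.

Section Volume.
Variables (R : realType) (d n : nat) (V : 'I_n -> 'rV[R]_d).
Let W := homog_rows V.
Let P := convex_hull V.
Hypothesis V_lattice : forall i, lattice_point (V i).
Hypothesis W_full : row_full W.
Hypothesis d_gt0 : (0 < d)%N.
Variable h : nat -> nat.
Hypothesis count_h : forall k,
  lattice_count (dilate k P) = (\sum_(j < d.+1) h j * 'C(k + d - j, d))%N.

(** A large multiple of the sum of the generators of a simplicial cone stays
in the cone after a bounded perturbation. *)
Lemma shift_into_cone : exists (N : nat) (c : 'rV[R]_d), lattice_point c /\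
  forall v : 'rV[R]_d, (forall i, `|v 0 i| <= 1) -> cone W (homog N%:R (v + c)).
Proof.
have [T [y [Tb _ Cy cov _]]] := exists_half_open_partition (homog_rows1 V)
  W_full.
have [S ST _] := cov y Cy; have bS := Tb S ST.
have LB := basis_lattice V_lattice bS; have [uB lB B1] := LB.
set B := basis_rows W S in LB uB lB B1 *.
(* A bound for the coordinates in B of the vectors with entries at most 1. *)
pose M := \sum_i \sum_j `|invmx B i j|.
pose t := (Num.truncn M).+1.
pose g : 'rV[R]_d.+1 := const_mx t%:R *m B.
have g0 : g 0 ord0 = (t * d.+1)%:R.
  rewrite (height_coords _ LB) coords_mul //.
  by under eq_bigr do rewrite mxE; rewrite sumr_const card_ord natrM mulr_natr.
exists (t * d.+1)%N, (tail g); split.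
  apply/(lattice_point_homog (t * d.+1)); rewrite -g0 tailK.
  by apply: lattice_point_mul => // i; rewrite mxE natr_int.
move=> v v1; have -> : homog (t * d.+1)%:R (v + tail g) = homog 0 v + g.
  by rewrite -{2}(tailK g) g0 -homogD add0r.
apply: (coords_ge0_cone bS) => i; rewrite coordsD coords_mul //
  [const_mx _ _ _]mxE.
suff : `|coords B (homog 0 v) 0 i| <= M.
  rewrite ler_norml => /andP[+ _]; have : M < t%:R by exact: truncnS_gt.
  by rewrite -/B; lra.
rewrite /coords mxE; apply: le_trans (ler_norm_sum _ _ _) _.
apply: ler_sum => j _; rewrite normrM (bigD1 i) //= -[leLHS]addr0 lerD //.
  rewrite -[leRHS]mul1r ler_wpM2r //.
  by case: (unliftP ord0 j) => [j'|] ->; rewrite ?homogSE ?homog0E ?normr0.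
by apply: sumr_ge0.
Qed.

Lemma finite_lattice_dilate k :
  finite_set (dilate k P `&` lattice_point (d := d)).
Proof.
have [T [y Ty]] := exists_half_open_partition (homog_rows1 V) W_full.
have [fA _] := card_cone_level V_lattice k Ty.
apply: (sub_finite_set _ (finite_image (@tail R d) fA)) => x [Px lx].
exists (homog k%:R x); last exact: homogK.
split; [split|exact: homog0E]; first by apply/(cone_dilate _ (row_full_gt0
  W_full)).
exact/lattice_point_homog.
Qed.

(** Each cube of side 1/k of the grid that meets the polytope is, after
scaling and translation, a lattice point of a slightly larger dilate. *)
Lemma lebesgue_le_count : exists N : nat, forall k, (0 < k)%N ->
  (lebesgue_rV P <= ((lattice_count (dilate (k + N) P))%:R / k%:R ^+ d)%:E)%E.
Proof.
have [N [c [lc Nc]]] := shift_into_cone; exists N => k k0.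
have k0' : 0 < k%:R :> R by rewrite ltr0n.
rewrite /lattice_count.
have [s [us sP <-]] := fset_set_enum (finite_lattice_dilate (k + N)).
(* Beyond the enumeration s the boxes are reduced to the origin. *)
pose a m : 'rV[R]_d := if (m < size s)%N then k%:R^-1 *: (nth 0 s m - c) else 0.
pose b m : 'rV[R]_d :=
  if (m < size s)%N then k%:R^-1 *: (nth 0 s m - c + const_mx 1) else 0.
have side m i : b m 0 i - a m 0 i = if (m < size s)%N then k%:R^-1 else 0.
  rewrite /a /b; case: ifP => _; last by rewrite !mxE subr0.
  by rewrite !mxE; ring.
apply: ge_ereal_inf; exists ((size s)%:R / k%:R ^+ d)%:E => //.
exists a, b; split.
- by move=> m i; rewrite -subr_ge0 side; case: ifP; rewrite ?invr_ge0 ?lexx.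
- move=> p Pp; pose z : 'rV[R]_d := \row_i (Num.floor (k%:R * p 0 i))%:~R.
  have zi i : z 0 i <= k%:R * p 0 i < z 0 i + 1.
    by rewrite mxE; have := floor_itv (k%:R * p 0 i); rewrite rmorphD.
  have zs : z + c \in s.
    apply/sP; split; last first.
      by apply: lattice_pointD lc => i; rewrite mxE intr_int.
    apply/(cone_dilate _ (row_full_gt0 W_full)).
    have -> : z + c = k%:R *: p + ((z - k%:R *: p) + c).
      by rewrite addrA [_ *: p + _]addrC subrK.
    rewrite natrD homogD -[X in cone _ X]addrC -[X in _ + X]scale1r.
    apply: coneD => //.
      by apply: Nc => i; have := zi i; rewrite !mxE ler_norml; lra.
    by apply/(cone_dilate _ (row_full_gt0 W_full)); exists p.
  exists (index (z + c) s) => //= i.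
  rewrite /a /b index_mem zs nth_index // addrK.
  have := zi i; rewrite !mxE => zp.
  by rewrite ler_pdivrMl // ler_pdivlMl //; lra.
- rewrite (@nneseries_split _ _ 0 (size s)); last first.
    move=> m _; rewrite lee_fin prodr_ge0 // => i _.
    by rewrite side; case: ifP; rewrite ?invr_ge0 ?lexx.
  rewrite [X in (_ + X)%E]eseries0 => [|m sm _]; last first.
    rewrite (bigD1 (Ordinal d_gt0)) //= side ltnNge.
    by rewrite (leq_trans _ sm) ?mul0r // add0n.
  rewrite adde0 add0n sumEFin; congr EFin.
  rewrite big_mkord (eq_bigr (fun=> k%:R^-1 ^+ d)) => [|m _].
    by rewrite sumr_const card_ord exprVn mulr_natl.
  rewrite (eq_bigr (fun=> k%:R^-1)) => [|i _]; last by rewrite side ltn_ord.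
  by rewrite prodr_const card_ord.
Qed.

Lemma compact_convex_hull : compact P.
Proof.
pose f (a : 'rV[R]_n) : 'rV[R]_d := \sum_i a 0 i *: V i.
pose K : set 'rV[R]_n := [set a | forall i, `[0, 1]%classic (a ord0 i)].
pose L : set 'rV[R]_n := (fun a : 'rV[R]_n => \sum_i a 0 i) @^-1` [set 1].
have -> : P = [set f a | a in K `&` L].
  apply/seteqP; split=> [x [a [a0 a1 ->]]|x [a [Ka La] <-]].
    exists (\row_i a i); last by apply: eq_bigr => i _; rewrite mxE.
    split=> [i|]; last by rewrite /L /= -[RHS]a1; apply: eq_bigr => i _;
      rewrite mxE.
    rewrite /= mxE in_itv /= a0 /= -a1 (bigD1 i) //= lerDl.
    by apply: sumr_ge0.
  exists (fun i => a 0 i); split=> // i.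
  by have := Ka i; rewrite /= in_itv /= => /andP[].
apply: continuous_compact.
  apply: continuous_subspaceT => a.
  apply: (@cvg_big _ _ +%R 0 xpredT add_continuous _ (nbhs a) _
    (fun i (a' : 'rV[R]_n) => a' 0 i *: V i) (fun i => a 0 i *: V i)
    (nbhs_filter a)) => i _.
  apply: cvgZr_tmp; exact: coord_continuous.
apply: compact_closedI.
  apply: (@rV_compact R n (fun=> `[0, 1]%classic)) => i.
  exact: segment_compact.
apply: preimage_closed => [a _|]; last exact: closed_eq.
apply: (@cvg_big _ _ +%R 0 xpredT add_continuous _ (nbhs a) _
  (fun i (a' : 'rV[R]_n) => a' 0 i) (fun i => a 0 i) (nbhs_filter a)) => i _.
exact: coord_continuous.
Qed.

Lemma open_box (a b : 'rV[R]_d) :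
  open [set x : 'rV[R]_d | forall i, a 0 i < x 0 i < b 0 i].
Proof.
rewrite openE => x xab.
suff : \forall y \near (x : 'rV[R]_d), forall i,
  a 0 i < (y : 'rV[R]_d) 0 i < b 0 i.
  by [].
apply: (@filter_forall _ _ (fun i (y : 'rV[R]_d) =>
  is_true (a 0 i < y 0 i < b 0 i)) _ (nbhs_filter x)) => i.
have /andP[xa xb] := xab i; have cx := @coord_continuous R 1 d 0 i x.
by apply: filterS2 (cvgr_gt _ cx _ xa) (cvgr_lt _ cx _ xb) => y ya yb;
  rewrite ya.
Qed.

(** A slight enlargement of the boxes makes them open, so that finitely many
of them cover the compact polytope; lattice points of dilates are then counted
box by box. *)
Lemma leading_coef_le_cover (a b : nat -> 'rV[R]_d) :
  (forall m i, a m 0 i <= b m 0 i) ->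
  P `<=` \bigcup_m [set x | forall i, a m 0 i <= x 0 i <= b m 0 i] ->
  (((\sum_(j < d.+1) h j)%:R / d`!%:R)%:E <=
   \sum_(0 <= m <oo) (\prod_(i < d) (b m 0 i - a m 0 i))%:E)%E.
Proof.
move=> ab Pab; apply/lee_addgt0Pr => e e0.
have vol_ge0 m : 0 <= \prod_(i < d) (b m 0 i - a m 0 i).
  by apply: prodr_ge0 => i _; rewrite subr_ge0.
(* The m-th box is enlarged by r m; this adds at most e to the total volume. *)
have [r rP] : exists r : nat -> R, forall m, 0 < r m /\
    \prod_(i < d) (b m 0 i - a m 0 i + 2 * r m) <=
    \prod_(i < d) (b m 0 i - a m 0 i) + e * 2^-1 ^+ m.+1.
  suff : forall m, exists r : R, 0 < r /\
      \prod_(i < d) (b m 0 i - a m 0 i + 2 * r) <=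
      \prod_(i < d) (b m 0 i - a m 0 i) + e * 2^-1 ^+ m.+1
        by move=> /choice[r rP]; exists r.
  move=> m; pose q : {poly R} := \prod_(i < d) ((b m 0 i - a m 0 i)%:P + 2
    *: 'X).
  have qE u : q.[u] = \prod_(i < d) (b m 0 i - a m 0 i + 2 * u).
    by rewrite horner_prod; apply: eq_bigr => i _; rewrite !hornerE.
  have em : 0 < e * 2^-1 ^+ m.+1 by rewrite mulr_gt0 ?exprn_gt0.
  apply: contrapT => no.
  have : q.[0] + e * 2^-1 ^+ m.+1 <= q.[0]; last by rewrite gerDl leNgt em.
  rewrite -[leLHS](hornerC _ 0); apply: horner0_le => k k0.
  rewrite hornerC leNgt; apply/negP => qk; apply: no.
  exists k%:R^-1; rewrite invr_gt0 ltr0n; split=> //.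
  rewrite -qE (le_trans (ltW qk)) // qE lerD2r.
  by under eq_bigr do rewrite mulr0 addr0.
pose U m : set 'rV[R]_d := [set x | forall i,
  (a m - const_mx (r m)) 0 i < x 0 i < (b m + const_mx (r m)) 0 i].
have := compact_convex_hull; rewrite compact_cover.
move=> /(_ nat setT U (fun m _ => @open_box _ _)) [x Px|D _ PD].
  have [m _ xm] := Pab x Px; exists m => // i.
  by rewrite !mxE; have := xm i; have [] := rP m; lra.
pose M := (\max_(m <- enum_fset D) m).+1.
have {}PD x : P x -> exists2 m, (m < M)%N & U m x.
  move=> /PD[m /= mD Um]; exists m => //; rewrite ltnS.
  by rewrite (big_rem m) //= leq_maxl.
pose q : {poly R} := \sum_(m < M) \prod_(i < d) ((b m 0 i - a m 0 i + 2
  * r m)%:P + 'X).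
have q0 : (\sum_(j < d.+1) h j)%:R / d`!%:R <= q.[0].
  rewrite -(scaled_count0 R d h 0); apply: horner0_le => k k0.
  have k0' : 0 < k%:R :> R by rewrite ltr0n.
  rewrite -(ler_pM2l (exprn_gt0 d k0')) -scaled_countE // addn0 -count_h.
  have abr m i : (k%:R *: (a m - const_mx (r m))) 0 i <=
      (k%:R *: (b m + const_mx (r m))) 0 i.
    by rewrite !mxE ler_pM2l //; have := ab m i; have [] := rP m; lra.
  have [s sP] := choice (fun m => lattice_box_cover (abr m)).
  have : (lattice_count (dilate k P) <= size (flatten
    [seq s m | m <- iota 0 M]))%N.
    apply: card_fset_set_sub => x [[p Pp <-] lx].
    have [m mM Um] := PD p Pp; apply/flattenP; exists (s m).
      by apply/mapP; exists m; rewrite // mem_iota.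
    apply: (sP m).1 => // i; have := Um i; rewrite !mxE => /andP[? ?].
    by rewrite !ler_pM2l // !ltW.
  rewrite size_flatten /shape -map_comp sumnE big_map -(ler_nat R) => /le_trans;
    apply.
  rewrite -[iota 0 M]/(index_iota 0 M) big_mkord natr_sum horner_sum mulr_sumr.
  apply: ler_sum => m _; apply: le_trans (sP m).2 _.
  rewrite horner_prod -[X in _ ^+ X]card_ord -prodr_const -big_split /=.
  apply: ler_prod => i _; rewrite !hornerE !mxE.
  have -> : k%:R * (b m 0 i + r m) - k%:R * (a m 0 i - r m) + 1 =
      k%:R * (b m 0 i - a m 0 i + 2 * r m + k%:R^-1) by field; rewrite gt_eqF.
  rewrite lexx andbT mulr_ge0 // addr_ge0 ?invr_ge0 //.
  by have := ab m i; have [] := rP m; lra.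
apply: le_trans (_ : (q.[0])%:E <= _)%E; first by rewrite lee_fin.
apply: le_trans (_ : ((\sum_(m < M) \prod_(i < d) (b m 0 i - a m 0 i))
  + e)%:E <= _)%E.
  rewrite lee_fin horner_sum.
  have : \sum_(m < M) e * 2^-1 ^+ m.+1 <= e.
    have -> : \sum_(m < M) e * 2^-1 ^+ m.+1 = e * (1 - 2^-1 ^+ M).
      rewrite -mulr_sumr; congr (_ * _); elim: (M) => [|N IH].
        by rewrite big_ord0 subrr.
      by rewrite big_ord_recr /= IH exprS; field.
    by rewrite ger_pMr // gerDl oppr_le0 exprn_ge0.
  move=> /(lerD (lexx (\sum_(m < M) \prod_(i < d) (b m 0 i - a m 0 i)))).
  apply: le_trans; rewrite -big_split /=; apply: ler_sum => m _.
  apply: le_trans (rP m).2; rewrite horner_prod le_eqVlt; apply/orP; left.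
  by apply/eqP/eq_bigr => i _; rewrite !hornerE.
rewrite EFinD leeD2r // -sumEFin -(big_mkord xpredT (fun m =>
  (\prod_(i < d) (b m 0 i - a m 0 i))%:E)).
by apply: nneseries_lim_ge => m _ _; rewrite lee_fin.
Qed.

(** The volume is at least the leading coefficient, and at most the number of
lattice points of the dilate by k + N divided by k ^ d, which tends to it. *)
Theorem vol_convex_hull : vol P = (\sum_(j < d.+1) h j)%:R / d`!%:R.
Proof.
set A := _ / _; have A_le : (A%:E <= lebesgue_rV P)%E.
  apply: le_ereal_inf_tmp => l [a [b [ab Pab ->]]].
  exact: leading_coef_le_cover.
have [N N_le] := lebesgue_le_count; rewrite /vol.
case: (lebesgue_rV P) A_le N_le => [r||] //=; last by move=> _ /(_ 1%N isT).
rewrite lee_fin => Ar N_le; apply/eqP; rewrite eq_le Ar andbT.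
rewrite /A -(scaled_count0 R d h N) -[leLHS](hornerC r 0); apply: horner0_le =>
  k k0.
have := N_le k k0; rewrite lee_fin hornerC count_h scaled_countE
  // mulrAC mulfV ?mul1r //.
by rewrite expf_neq0 // pnatr_eq0 -lt0n.
Qed.

End Volume.

(** * Coefficients of the basis polynomials *)

Section Coefficients.
Variable R : realType.

(** This is d! times the binomial coefficient of X + d - j over d. *)
Definition numerator_poly d (j : nat) : {poly R} :=
  \prod_(l < d) ('X + ((d - j)%:R - l%:R)%:P).

Definition numerator_coef d (j i : nat) : R := (numerator_poly d j)`_i.

Lemma coefMXaddC (S : comNzRingType) (p : {poly S}) c i :
  (p * ('X + c%:P))`_i.+1 = p`_i + p`_i.+1 * c.
Proof. by rewrite mulrDr coefD coefMX coefMC. Qed.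

Lemma coef0MXaddC (S : comNzRingType) (p : {poly S}) c :
  (p * ('X + c%:P))`_0 = p`_0 * c.
Proof. by rewrite mulrDr coefD coefMX coefMC add0r. Qed.

Definition harmonic_sum n : R := \sum_(r < n) r.+1%:R^-1.

Lemma harmonic_sum_le m n : (m <= n)%N -> harmonic_sum m <= harmonic_sum n.
Proof.
move=> mn; rewrite /harmonic_sum (big_ord_widen n (fun r => r.+1%:R^-1) mn).
rewrite [leRHS](bigID (fun i : 'I_n => (i < m)%N)) /= lerDl.
by rewrite sumr_ge0.
Qed.

Definition rising n : {poly R} := \prod_(r < n) ('X + r.+1%:R%:P).
Definition falling n : {poly R} := \prod_(r < n) ('X + (- r.+1%:R)%:P).

Lemma rising_coef0 n : (rising n)`_0 = n`!%:R.
Proof.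
elim: n => [|n IH]; first by rewrite /rising big_ord0 coef1.
by rewrite /rising big_ord_recr coef0MXaddC -/(rising n) IH -natrM mulnC.
Qed.

Lemma rising_coef1 n : (rising n)`_1 = n`!%:R * harmonic_sum n.
Proof.
elim: n => [|n IH].
  by rewrite /rising /harmonic_sum !big_ord0 coef1 mulr0.
rewrite /rising big_ord_recr coefMXaddC -/(rising n) IH rising_coef0.
rewrite /harmonic_sum big_ord_recr -/(harmonic_sum n) factS natrM /=.
by field; rewrite nat1r pnatr_eq0.
Qed.

Lemma rising_falling n i : (rising n)`_i = (-1) ^+ (n + i) * (falling n)`_i.
Proof.
elim: n i => [|n IH] i.
  rewrite /rising /falling !big_ord0 coef1; case: i => [|i];
    last by rewrite mulr0.
  by rewrite expr0 mulr1.
rewrite /rising /falling !big_ord_recr /= -/(rising n) -/(falling n).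
case: i => [|i].
  by rewrite !coef0MXaddC IH addn0 addSn addn0 exprS; ring.
by rewrite !coefMXaddC !IH addnS addSn addnS !exprS; ring.
Qed.

Lemma falling_coef0 n : (falling n)`_0 = (-1) ^+ n * n`!%:R.
Proof. by rewrite -rising_coef0 rising_falling addn0 mulrA
  -expr2 sqrr_sign mul1r. Qed.

Lemma falling_coef1 n :
  (falling n)`_1 = - ((-1) ^+ n * (n`!%:R * harmonic_sum n)).
Proof.
rewrite -rising_coef1 rising_falling addn1 exprS mulN1r mulNr mulrN opprK.
by rewrite mulrA -expr2 sqrr_sign mul1r.
Qed.

(** For j > 0 the factor with l = d - j is X itself; the factors before and
after it have roots of opposite signs. *)
Lemma numerator_poly_split d j : (0 < j <= d)%N ->
  numerator_poly d j = rising (d - j) * falling j.-1 * 'X.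
Proof.
move=> /andP[j0 jd]; rewrite /numerator_poly.
have -> : \prod_(l < d) ('X + ((d - j)%:R - l%:R)%:P) =
    \prod_(0 <= l < d) ('X + ((d - j)%:R - l%:R)%:P) :> {poly R}.
  by rewrite big_mkord.
rewrite (@big_cat_nat _ _ _ (d - j)) ?leq_subr //= -mulrA; congr (_ * _).
  rewrite big_mkord (reindex_inj rev_ord_inj) /=; apply: eq_bigr => l _.
  rewrite -natrB; last by have := ltn_ord l; lia.
  by congr ('X + (_%:R)%:P); have := ltn_ord l; lia.
rewrite big_ltn ?[X in X * _]addr0; last by lia.
rewrite subrr addr0 mulrC; congr (_ * _).
rewrite -[(d - j).+1]add0n big_addn big_mkord.
have -> : (d - (d - j).+1 = j.-1)%N by lia.
apply: eq_bigr => l _; congr ('X + _%:P).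
by rewrite natrD -natr1 -addn1 natrD; ring.
Qed.

Lemma numerator_coef1 d j : (0 < j <= d)%N ->
  numerator_coef d j 1 = (-1) ^+ j.-1 * ((d - j)`! * j.-1`!)%:R.
Proof.
move=> jd; rewrite /numerator_coef numerator_poly_split // coefMX /= coef0M.
by rewrite rising_coef0 falling_coef0 natrM mulrCA.
Qed.

Lemma numerator_coef2 d j : (0 < j <= d)%N ->
  numerator_coef d j 2 = (-1) ^+ j.-1 * ((d - j)`! * j.-1`!)%:R *
    (harmonic_sum (d - j) - harmonic_sum j.-1).
Proof.
move=> jd; rewrite /numerator_coef numerator_poly_split // coefMX /= coefM.
rewrite !big_ord_recl big_ord0 /= rising_coef0 falling_coef0 rising_coef1
  falling_coef1.
by rewrite natrM; ring.
Qed.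

Lemma numerator_poly0 d : numerator_poly d 0 = rising d.
Proof.
rewrite /numerator_poly subn0 (reindex_inj rev_ord_inj) /=; apply: eq_bigr =>
  l _.
rewrite -natrB; last by have := ltn_ord l; lia.
by congr ('X + (_%:R)%:P); have := ltn_ord l; lia.
Qed.

Lemma stirl_falling n i : (stirl n.+1 i.+1)%:~R = (falling n)`_i :> R.
Proof.
rewrite /stirl big_ord_recl /= subr0 mulrC coefMX /=.
set p : {poly int} := \prod_(l < n) _.
suff -> : falling n = map_poly intr p by rewrite coef_map.
rewrite rmorph_prod; apply: eq_bigr => l _.
by rewrite rmorphB /= map_polyX map_polyC /= rmorph_nat polyCN.
Qed.

(** The second elementary symmetric function of d consecutive numbers is a
quadratic function of their mean. *)
Lemma numerator_coef_codim2 d j : (2 <= d)%N -> (j <= d)%N ->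
  numerator_coef d j (d - 2) =
  d%:R * (d%:R - 1) / 2 * ((d%:R + 1 - 2 * j%:R) ^+ 2 / 4 - (d%:R + 1) / 12).
Proof.
move=> d2 jd; set c := (d - j)%:R : R.
pose p n : {poly R} := \prod_(l < n) ('X + (c - l%:R)%:P).
have pS n : p n.+1 = p n * ('X + (c - n%:R)%:P) by rewrite /p big_ord_recr.
have pz n i : (n < i)%N -> (p n)`_i = 0.
  elim: n i => [|n IH] [|i] // ni; first by rewrite /p big_ord0 coef1.
  by rewrite pS coefMXaddC !IH ?mul0r ?addr0 // ltnW.
have p0 n : (p n)`_n = 1.
  elim: n => [|n IH]; first by rewrite /p big_ord0 coef1.
  by rewrite pS coefMXaddC IH pz // mul0r addr0.
have p1 n : (p n.+1)`_n = n.+1%:R * c - n.+1%:R * n%:R / 2.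
  elim: n => [|n IH].
    by rewrite pS coef0MXaddC p0; ring.
  by rewrite pS coefMXaddC IH p0 -[n.+2%:R]natr1 -[n.+1%:R]natr1; field.
have p2 n : (p n.+2)`_n = n.+2%:R * (n.+2%:R - 1) / 2 *
    ((2 * c - (n.+2%:R - 1)) ^+ 2 / 4 - (n.+2%:R + 1) / 12).
  elim: n => [|n IH].
    by rewrite pS coef0MXaddC p1; field.
  by rewrite pS coefMXaddC IH p1 -[n.+3%:R]natr1 -[n.+2%:R]natr1
    -[n.+1%:R]natr1; field.
have dE : d = (d - 2).+2 by lia.
have := p2 (d - 2)%N; rewrite -dE => {}p2; rewrite /numerator_coef [LHS]p2.
by rewrite /c natrB //; congr (_ * (_ ^+ 2 / 4 - _)); ring.
Qed.

(** * Extreme weights *)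

Lemma fact_mul_le a b : (0 < a)%N -> (0 < b)%N -> (a`! * b`! <= (a + b).-1`!)%N.
Proof.
move=> a0; case: b => // b _; elim: b => [|b IH].
  by rewrite addn1 muln1.
rewrite factS mulnCA addnS /= -[(a + b.+1)%N]prednK ?addn_gt0 ?a0 // factS.
apply: leq_mul => //; rewrite prednK ?addn_gt0 ?a0 //; lia.
Qed.

Lemma signed_ge (n : nat) (x y : R) : `|x| <= y -> - y <= (-1) ^+ n * x.
Proof.
move=> xy; rewrite lerNl (le_trans _ xy) // (le_trans (ler_norm _)) //.
by rewrite normrN normrM normrX normrN1 expr1n mul1r.
Qed.

Lemma harmonic_sum1 : harmonic_sum 1 = 1.
Proof. by rewrite /harmonic_sum big_ord1 invr1. Qed.

(** The weights have absolute value (d - j)! (j - 1)!, which is at most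
(d - 2)!, the absolute value of the negative weight at j = 2. *)
Lemma numerator_coef1_ge d j : (2 <= j < d)%N ->
  numerator_coef d 2 1 <= numerator_coef d j 1.
Proof.
move=> jd; rewrite !numerator_coef1 /=; try lia.
rewrite ?expr1 ?mulN1r ?muln1 signed_ge // ger0_norm // ler_nat.
have -> : (d - 2 = ((d - j) + j.-1).-1)%N by lia.
by apply: fact_mul_le; lia.
Qed.

(** Both harmonic sums lie between 1 and the one of length d - 2, and their
difference is extreme at j = 2. *)
Lemma numerator_coef2_ge d j : (2 <= j < d)%N ->
  numerator_coef d 2 2 <= numerator_coef d j 2.
Proof.
move=> jd; rewrite !numerator_coef2 /=; try lia.
rewrite ?expr1 ?muln1 ?mulN1r mulNr -[leRHS]mulrA signed_ge
  // normrM ger0_norm //.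
rewrite ler_pM // ?ler_nat; last 1 first.
  have h1 : harmonic_sum 1 <= harmonic_sum (d - j) by apply: harmonic_sum_le;
    lia.
  have h2 : harmonic_sum 1 <= harmonic_sum j.-1 by apply: harmonic_sum_le; lia.
  have h3 : harmonic_sum (d - j) <= harmonic_sum (d - 2)
    by apply: harmonic_sum_le; lia.
  have h4 : harmonic_sum j.-1 <= harmonic_sum (d - 2) by apply: harmonic_sum_le;
    lia.
  by rewrite ler_norml; lra.
have -> : (d - 2 = ((d - j) + j.-1).-1)%N by lia.
by apply: fact_mul_le; lia.
Qed.

Lemma uphalf_offset d : d%:R + 1 - 2 * (uphalf d)%:R = (~~ odd d)%:R :> R.
Proof.
have dE : d%:R = (odd d)%:R + 2 * (d./2)%:R :> R.
  by rewrite -{1}(odd_double_half d) natrD -mul2n natrM.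
by rewrite uphalf_half natrD dE; case: (odd d) => /=; ring.
Qed.

(** The offset d + 1 - 2 j is an integer with the parity of d + 1, so its square
is least when it is 0 or 1. *)
Lemma numerator_coef_codim2_ge d j : (2 <= d)%N -> (j <= d)%N ->
  numerator_coef d (uphalf d) (d - 2) <= numerator_coef d j (d - 2).
Proof.
move=> d2 jd; rewrite !numerator_coef_codim2 //; last by rewrite uphalf_half;
  have := odd_double_half d; lia.
have d0 : 2 <= d%:R :> R by rewrite ler_nat.
have d1 : 0 <= d%:R * (d%:R - 1) / 2 :> R.
  by rewrite divr_ge0 // mulr_ge0 // subr_ge0; lra.
rewrite ler_wpM2l //.
rewrite lerD2r ler_wpM2r ?invr_ge0 //.
rewrite uphalf_offset; case: (odd d) (odd_double_half d) => dE.
  by rewrite expr0n sqr_ge0.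
rewrite expr1n -[X in X <= _](expr1n _ 2) -[leRHS]real_normK ?num_real
  // ler_pXn2r ?nnegrE //.
have -> : d%:R + 1 - 2 * j%:R = (d%:Z + 1 - 2 * j%:Z)%:~R :> R
  by rewrite rmorphB rmorphD rmorphM.
rewrite norm_intr_ge1 ?intr_int // intr_eq0; move: dE; lia.
Qed.

(** The terms for j = 1 and j = d are bounded together: as h d <= h 1, their sum
is at least h d * (C 1 + C d) and hence nonnegative, even if C d < M. *)
Lemma hstar_bound d (h : nat -> nat) (C : nat -> R) M : (2 <= d)%N ->
  h 0%N = 1%N -> (h d <= h 1%N)%N -> M <= 0 -> 0 <= C 1%N -> 0 <= C 1%N + C d ->
  (forall j, (2 <= j < d)%N -> M <= C j) ->
  C 0%N + M * ((\sum_(j < d.+1) h j)%:R - 1) <= \sum_(j < d.+1) (h j)%:R * C j.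
Proof.
case: d => [|[|d]] // _ h0 hd M0 C1 C1d CM.
have split_ends (F : nat -> R) :
    \sum_(j < d.+3) F j = F 0%N + (F 1%N + F d.+2 + \sum_(i < d) F i.+2).
  by rewrite big_ord_recl big_ord_recl big_ord_recr -addrA /= [X in _ = _ + (_
    + X)]addrC.
rewrite natr_sum (split_ends (fun j => (h j)%:R)) (split_ends (fun j =>
  (h j)%:R * C j)).
rewrite h0 mul1r lerD2l addrAC subrr add0r mulrDr lerD //.
  set a := (h 1)%:R; set b := (h d.+2)%:R; have ab : b <= a by rewrite ler_nat.
  have -> : a * C 1%N + b * C d.+2 = (a - b) * C 1%N + b * (C 1%N + C d.+2)
    by ring.
  apply: (@le_trans _ _ 0); first by rewrite mulr_le0_ge0 // addr_ge0 // ler0n.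
  by rewrite addr_ge0 // mulr_ge0 // subr_ge0.
rewrite mulr_sumr; apply: ler_sum => i _; rewrite mulrC ler_wpM2l // CM //.
by have := ltn_ord i; lia.
Qed.

(** * The Ehrhart coefficients in terms of the h-vector *)

Lemma numerator_poly_bin d j k : (j <= d)%N ->
  'C(k + d - j, d)%:R = (numerator_poly d j).[k%:R] / d`!%:R :> R.
Proof.
move=> jd; rewrite natr_bin mulrC /numerator_poly horner_prod; congr (_ / _).
apply: eq_bigr => l _; rewrite hornerD hornerX hornerC addrA -natrD.
by congr (_%:R - _); lia.
Qed.

Lemma poly_nat_inj (p q : {poly R}) : (forall k : nat, p.[k%:R] = q.[k%:R]) ->
  p = q.
Proof.
move=> pq; apply/eqP; rewrite -subr_eq0; apply/negPn/negP => nz.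
pose s : seq R := [seq i%:R | i <- iota 0 (size (p - q))].
have us : uniq s.
  by rewrite map_inj_uniq ?iota_uniq // => i j /eqP; rewrite eqr_nat => /eqP.
have rs : all (root (p - q)) s.
  apply/allP => _ /mapP[i _ ->].
  by rewrite /root hornerD hornerN pq subrr.
by have := max_poly_roots nz rs us; rewrite size_map size_iota ltnn.
Qed.

Lemma ehrhart_coef_hstar d (P : set 'rV[R]_d) (h : nat -> nat) i :
  (forall k, lattice_count (dilate k P) =
     (\sum_(j < d.+1) h j * 'C(k + d - j, d))%N) ->
  ehrhart_coef i P = (\sum_(j < d.+1) (h j)%:R * numerator_coef d j i) / d`!%:R.
Proof.
move=> Ph; pose p : {poly R} :=
  \sum_(j < d.+1) ((h j)%:R / d`!%:R) *: numerator_poly d j.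
have pP (k : nat) : (lattice_count (dilate k P))%:R = p.[k%:R].
  rewrite Ph natr_sum horner_sum; apply: eq_bigr => j _.
  have jd : (j <= d)%N by rewrite -ltnS.
  by rewrite natrM numerator_poly_bin // hornerZ; ring.
rewrite /ehrhart_coef; have -> : ehrhart_poly P = p.
  apply: poly_nat_inj => k; rewrite -pP /ehrhart_poly.
  by rewrite -(xgetI (P := [set p : {poly R} |
            forall k : nat, (lattice_count (dilate k P))%:R = p.[k%:R]]) 0 pP).
rewrite coef_sum mulr_suml; apply: eq_bigr => j _.
by rewrite coefZ /numerator_coef; ring.
Qed.

Lemma harmonic_sumS n : harmonic_sum n.+1 = harmonic_sum n + n.+1%:R^-1.
Proof. by rewrite /harmonic_sum big_ord_recr. Qed.

(** Each bound is the value obtained for the h-vector with 1 at index 0 and the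
rest of the mass at the index of the least weight. *)
Lemma g1_boundE d (A : R) : (2 <= d)%N -> g1_bound d (A / d`!%:R) =
  (numerator_coef d 0 1 + numerator_coef d 2 1 * (A - 1)) / d`!%:R.
Proof.
case: d => [|[|d]] // _; rewrite (@numerator_coef1 d.+2 2)
  // /numerator_coef numerator_poly0.
rewrite rising_coef1 /g1_bound !subSS !subn0 -[(2.-1)`!]/1%N !muln1.
have -> : \sum_(1 <= j < d.+1) j%:R^-1 = harmonic_sum d.
  by rewrite big_add1 /= big_mkord.
rewrite !harmonic_sumS !factS !natrM -[d.+2%:R]natr1 -[d.+1%:R]natr1.
by field; rewrite !natr1 !pnatr_eq0 -!lt0n fact_gt0.
Qed.

Lemma g2_boundE d (A : R) : (2 <= d)%N -> g2_bound d (A / d`!%:R) =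
  (numerator_coef d 0 2 + numerator_coef d 2 2 * (A - 1)) / d`!%:R.
Proof.
case: d => [|[|d]] // _; rewrite (@numerator_coef2 d.+2 2)
  // /numerator_coef numerator_poly0.
rewrite rising_falling -stirl_falling /g2_bound addn1 !subSS
  !subn0 (stirl_falling d 1).
rewrite falling_coef1 harmonic_sum1 addn2 !exprS !mulN1r !opprK
  -[(2.-1)`!]/1%N muln1.
have f0 : d.+2`!%:R != 0 :> R by [].
rewrite [d.+2`!%:R * _]mulrC divfK //.
have s2 : (-1) ^+ d * (-1) ^+ d = 1 :> R by rewrite -expr2 sqrr_sign.
set s : R := (-1) ^+ d in s2 *; set st := (stirl _ _)%:~R.
transitivity ((s * st + (s * s) * (d`!%:R - d`!%:R * harmonic_sum d) * (A
  - 1)) / d.+2`!%:R).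
  by ring.
by rewrite s2; ring.
Qed.

Lemma gdm2_boundE d (A : R) : (2 <= d)%N -> gdm2_bound d (A / d`!%:R) =
  (numerator_coef d 0 (d - 2) + numerator_coef d (uphalf d) (d - 2) * (A - 1))
  / d`!%:R.
Proof.
move=> d2; have f0 : d`!%:R != 0 :> R by [].
rewrite !numerator_coef_codim2 //; last by rewrite uphalf_half; have :=
  odd_double_half d; lia.
rewrite /gdm2_bound -[(d - 2)%:R * _ * _]mulrA.
have -> : d`!%:R * (A / d`!%:R) = A by rewrite mulrC divfK.
have d1 : (d - 1)%:R = d%:R - 1 :> R by rewrite natrB // ltnW.
case: ifP => [od|/negbT ed].
  have -> : 2 * (uphalf d)%:R = d%:R + 1 :> R.
    rewrite natr1 -natrM; congr _%:R; rewrite uphalf_half od.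
    by have := odd_double_half d; lia.
  by rewrite !natrM d1 natrD; field.
have -> : 2 * (uphalf d)%:R = d%:R :> R.
  rewrite -natrM; congr _%:R; rewrite uphalf_half (negPf ed).
  by have := odd_double_half d; lia.
by rewrite !natrM d1 natrD natrB //; field.
Qed.

End Coefficients.

(** * Polytopes and their vertices *)

Section Polytopes.
Variables (R : realType) (d : nat).
Implicit Types P : set 'rV[R]_d.

Lemma convex_hull_drop n (V : 'I_n.+1 -> 'rV[R]_d) i :
  convex_hull (fun k => V (lift i k)) (V i) ->
  convex_hull V = convex_hull (fun k => V (lift i k)).
Proof.
move=> [q [q0 q1 Vi]]; apply/seteqP; split=> x [a [a0 a1 ->]].
  exists (fun k => a (lift i k) + a i * q k); split.
  - by move=> k; rewrite addr_ge0 // mulr_ge0.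
  - by rewrite big_split /= -mulr_sumr q1 mulr1 addrC -[RHS]a1
    [RHS](bigD1_ord i).
  - rewrite (bigD1_ord i) //= Vi scaler_sumr addrC -big_split /=.
    by apply: eq_bigr => k _; rewrite scalerA -scalerDl.
exists (fun s => if unlift i s is Some k then a k else 0); split.
- by move=> s; case: unlift.
- by rewrite (bigD1_ord i) //= unlift_none add0r -a1; apply: eq_bigr => k _;
  rewrite liftK.
- rewrite [RHS](bigD1_ord i) //= unlift_none scale0r add0r.
  by apply: eq_bigr => k _; rewrite liftK.
Qed.

(** In a generating family of minimal size no point is a proper convex
combination of points of the polytope. *)
Lemma convex_polytope_vertices P : convex_polytope P ->
  exists n (V : 'I_n -> 'rV[R]_d), P = convex_hull V /\ forall i,
    vertex P (V i).
Proof.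
move=> PP; have exP : exists n, `[< exists V : 'I_n -> 'rV[R]_d,
  P = convex_hull V >].
  by have [n [V PV]] := PP; exists n; apply/asboolP; exists V.
case: (ex_minnP exP) => n /asboolP[V PV] min_n; exists n, V; split=> // i.
have Pi : P (V i) by rewrite PV; apply: convex_hull_vertex.
split=> // x y t Px Py t01 Vi; apply: contrapT => xy.
case: n V PV min_n i Pi Vi xy => [|n] V PV min_n i Pi Vi xy; first by case: (i).
suff : `[< exists V : 'I_n -> 'rV[R]_d, P = convex_hull V >].
  by move=> /min_n; rewrite ltnn.
apply/asboolP; exists (fun k => V (lift i k)); rewrite PV;
  apply: convex_hull_drop.
move: Px Py; rewrite PV => -[a [a0 a1 xa]] [b [b0 b1 yb]].
have /andP[t0 t1] := t01; have t1' : 0 < 1 - t by rewrite subr_gt0.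
have sum_rest (u : 'I_n.+1 -> R) : \sum_i u i = 1 ->
  \sum_k u (lift i k) = 1 - u i.
  by rewrite (bigD1_ord i) //= => <-; rewrite addrAC subrr add0r.
have le1 (u : 'I_n.+1 -> R) : (forall i, 0 <= u i) -> \sum_i u i = 1 ->
  u i <= 1.
  by move=> u0 u1; rewrite -subr_ge0 -sum_rest // sumr_ge0.
have eq1 (u : 'I_n.+1 -> R) z : (forall i, 0 <= u i) -> \sum_i u i = 1 ->
    z = \sum_i u i *: V i -> u i = 1 -> z = V i.
  move=> u0 u1 -> ui; rewrite (bigD1_ord i) //= ui scale1r big1 ?addr0 // =>
    k _.
  have /eqP := sum_rest u u1; rewrite ui subrr psumr_eq0 // => /allP h.
  by have /eqP -> := h k (mem_index_enum _); rewrite scale0r.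
pose c s := t * a s + (1 - t) * b s.
have c0 s : 0 <= c s by rewrite addr_ge0 // mulr_ge0 // ltW.
have c1 : \sum_s c s = 1.
  by rewrite big_split /= -!mulr_sumr a1 b1 !mulr1 addrC subrK.
have ci : c i < 1.
  rewrite lt_neqAle le1 // andbT; apply/eqP => ci; apply: xy.
  have ai := le1 a a0 a1; have bi := le1 b b0 b1.
  split; [apply: (eq1 a)|apply: (eq1 b)] => //; apply/eqP;
    rewrite eq_le ?ai ?bi /=.
    by move: ci; rewrite /c; nra.
  by move: ci; rewrite /c; nra.
have ci0 : 0 < 1 - c i by rewrite subr_gt0.
exists (fun k => c (lift i k) / (1 - c i)); split.
- by move=> k; rewrite divr_ge0 // ltW.
- by rewrite -mulr_suml sum_rest // mulfV // gt_eqF.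
- have e : V i = c i *: V i + \sum_k c (lift i k) *: V (lift i k).
    rewrite {1}Vi xa yb !scaler_sumr -big_split /= (bigD1_ord i) //=.
    rewrite !scalerA -scalerDl; congr (_ + _); apply: eq_bigr => k _.
    by rewrite !scalerA -scalerDl.
  have {}e : (1 - c i) *: V i = \sum_k c (lift i k) *: V (lift i k).
    by rewrite scalerBl scale1r {1}e addrAC subrr add0r.
  rewrite -[LHS](scalerK (lt0r_neq0 ci0)) e scaler_sumr.
  by apply: eq_bigr => k _; rewrite scalerA mulrC.
Qed.

(** A generator with a nonzero weight in a representation of v is an end of a
segment of the hull with v in its interior, unless it is v. *)
Lemma vertex_convex_hull n (V : 'I_n -> 'rV[R]_d) v :
  vertex (convex_hull V) v -> exists i, v = V i.
Proof.
move=> [[a [a0 a1 va]] v_ext].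
have [i ai] : exists i, 0 < a i.
  apply: contrapT => /forallNP noa; have := oner_neq0 R;
    rewrite -a1 big1 ?eqxx // => i _.
  by apply/eqP; rewrite eq_le a0 andbT leNgt; apply/negP/noa.
exists i; case: n V a a0 a1 va v_ext i ai => [|n] V a a0 a1 va v_ext i ai;
  first by case: (i).
have rest : \sum_k a (lift i k) = 1 - a i.
  by rewrite -a1 [in RHS](bigD1_ord i) //= addrAC subrr add0r.
have ai1 : a i <= 1 by rewrite -subr_ge0 -rest sumr_ge0.
have [ai_1|ai_n1] := eqVneq (a i) 1.
  rewrite va (bigD1_ord i) //= ai_1 scale1r big1 ?addr0 // => k _.
  have /eqP := rest; rewrite ai_1 subrr psumr_eq0 // => /allP h.
  by have /eqP -> := h k (mem_index_enum _); rewrite scale0r.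
have ai_lt1 : a i < 1 by rewrite lt_neqAle ai_n1.
have ai' : 0 < 1 - a i by rewrite subr_gt0.
pose q : 'rV[R]_d := (1 - a i)^-1 *: \sum_k a (lift i k) *: V (lift i k).
have Pq : convex_hull V q.
  exists (fun s => if unlift i s is Some k then a (lift i k) / (1
    - a i) else 0).
  split.
  - by move=> s; case: unlift => // k; rewrite divr_ge0 // ltW.
  - rewrite (bigD1_ord i) //= unlift_none add0r -[RHS](mulfV (lt0r_neq0 ai'))
    -[in RHS]rest mulr_suml.
    by apply: eq_bigr => k _; rewrite liftK rest.
  - rewrite (bigD1_ord i) //= unlift_none scale0r add0r /q scaler_sumr.
    by apply: eq_bigr => k _; rewrite liftK scalerA mulrC.
have vE : v = a i *: V i + (1 - a i) *: q.
  by rewrite va (bigD1_ord i) //= /q scalerA mulfV ?scale1r //;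
    exact: lt0r_neq0.
have [|Vi _] := v_ext (V i) q (a i) (convex_hull_vertex V i) Pq _ vE;
  last by [].
by rewrite ai.
Qed.

Lemma affine_dim_full P : (0 < d)%N -> affine_dim P = d <->
  exists (x0 : 'rV[R]_d) (A : 'M[R]_d),
    [/\ P x0, forall i, P (x0 + row i A) & row_free A].
Proof.
move=> d_gt0; rewrite /affine_dim; split=> [dimP|[x0 [A PA]]]; last first.
  apply/eqP; rewrite eqn_leq; apply/andP; split.
    by apply/bigmax_leqP => i _; rewrite -ltnS.
  by apply: (leq_bigmax_cond ord_max); apply/asboolP; exists x0, A.
apply: contrapT => noP.
suff : (d <= d.-1)%N by lia.
rewrite -{1}dimP; apply/bigmax_leqP => k /asboolP[x0 [A PA]].
suff : k != d :> nat by have := ltn_ord k; lia.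
apply/eqP => kd; apply: noP; move: A PA; rewrite kd => A PA.
by exists x0, A.
Qed.

Lemma row_full_homog_rows n (V : 'I_n -> 'rV[R]_d) : (0 < d)%N ->
  affine_dim (convex_hull V) = d -> row_full (homog_rows V).
Proof.
move=> d_gt0 /(affine_dim_full _ d_gt0)[x0 [A [Px0 PA fA]]].
have PW p : convex_hull V p -> (homog 1 p <= homog_rows V)%MS.
  rewrite -[X in convex_hull V X]scale1r -[X in X *: p]invr1.
  by move=> /(cone_homog _ _ ltr01)[a [_ ->]]; rewrite submxMl.
have uA : A \in unitmx by rewrite -row_free_unit.
rewrite -sub1mx; apply/row_subP => j; set z := row j _.
have -> : z = z 0 ord0 *: homog 1 x0 +
    \sum_i ((tail z - z 0 ord0 *: x0) *m invmx A) 0 i *: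
      (homog 1 (x0 + row i A) - homog 1 x0).
  have dif i : homog 1 (x0 + row i A) - homog 1 x0 = homog 0 (row i A).
    by apply/eqP; rewrite subr_eq -homogD add0r addrC.
  under eq_bigr do rewrite dif -homogZ mulr0.
  rewrite -homog_sum big1_eq -mulmx_sum_row mulmxKV // -homogZ mulr1
    -homogD addr0.
  by rewrite addrC subrK tailK.
rewrite addmx_sub ?scalemx_sub ?PW // summx_sub // => i _.
by rewrite scalemx_sub // addmx_sub ?eqmx_opp ?PW.
Qed.

End Polytopes.

(** * The lower bounds *)

Section LowerBounds.
Variables (R : realType) (d : nat).
Hypothesis d_ge3 : (3 <= d)%N.

(** The pairs are an Ehrhart coefficient and the index of its least weight. *)
Lemma lower_bounds (h : nat -> nat) :
  h 0%N = 1%N -> (h d <= h 1%N)%N ->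
  let A := (\sum_(j < d.+1) h j)%:R : R in
  forall i, i \in [:: (1, 2); (2, 2); (d - 2, uphalf d)]%N ->
  numerator_coef R d 0 i.1 + numerator_coef R d i.2 i.1 * (A - 1) <=
  \sum_(j < d.+1) (h j)%:R * numerator_coef R d j i.1.
Proof.
move=> h0 hd A i; rewrite !inE => /or3P[] /eqP -> /=.
- apply: (@hstar_bound R d h (fun j => numerator_coef R d j 1)) => //;
  first by lia.
  + by rewrite numerator_coef1 ?mulN1r ?oppr_le0 ?ler0n //; lia.
  + by rewrite numerator_coef1 ?expr0 ?mul1r ?ler0n //; lia.
  + rewrite !numerator_coef1; try lia.
    rewrite subnn subn1 /= mul1n muln1 expr0 mul1r -lerBlDl sub0r.
    by apply: signed_ge; rewrite ger0_norm.
  + by move=> j jd; apply: numerator_coef1_ge.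
- apply: (@hstar_bound R d h (fun j => numerator_coef R d j 2)) => //;
  first by lia.
  + rewrite numerator_coef2; last by lia.
    have : harmonic_sum R 1 <= harmonic_sum R (d - 2) by apply: harmonic_sum_le;
      lia.
    by move=> ?; rewrite mulr_le0_ge0 ?subr_ge0 // mulN1r oppr_le0 ler0n.
  + rewrite numerator_coef2; last by lia.
    by rewrite expr0 mul1r mulr_ge0 ?ler0n // subr_ge0 harmonic_sum_le.
  + rewrite !numerator_coef2; try lia.
    rewrite subnn subn1 /= mul1n muln1 expr0 mul1r -lerBlDl sub0r.
    have -> : harmonic_sum R 0 = 0 by rewrite /harmonic_sum big_ord0.
    rewrite subr0 sub0r -mulrA; apply: signed_ge.
    rewrite normrM normrN !ger0_norm //.
    by rewrite -[0](_ : harmonic_sum R 0 = 0) ?harmonic_sum_le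
      // /harmonic_sum big_ord0.
  + by move=> j jd; apply: numerator_coef2_ge.
- have d2 : (2 <= d)%N by lia.
  have dR : 3 <= d%:R :> R by rewrite ler_nat.
  have nonneg j : (j <= d)%N -> (d%:R + 1 - 2 * j%:R) ^+ 2 = (d%:R
    - 1) ^+ 2 :> R ->
      0 <= numerator_coef R d j (d - 2).
    move=> jd e; rewrite numerator_coef_codim2 // e.
    by rewrite mulr_ge0 //; nra.
  have c1 : 0 <= numerator_coef R d 1 (d - 2).
    by apply: nonneg; [lia|congr (_ ^+ 2); ring].
  have cd : 0 <= numerator_coef R d d (d - 2).
    by apply: nonneg => //; ring.
  apply: (@hstar_bound R d h (fun j => numerator_coef R d j (d - 2))) => //;
    rewrite ?addr_ge0 //.
  + rewrite numerator_coef_codim2 //; last by rewrite uphalf_half; have :=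
    odd_double_half d; lia.
    rewrite uphalf_offset mulr_ge0_le0 //;
      first by rewrite divr_ge0 // mulr_ge0 //; lra.
    by case: (odd d); rewrite /= ?expr0n ?expr1n /=; lra.
  + by move=> j jd; apply: numerator_coef_codim2_ge => //; lia.
Qed.

End LowerBounds.

(** * Simplices with a prescribed h-vector *)

Section UnitSimplicialCone.
Variables (R : realType) (d : nat) (V : 'I_d.+1 -> 'rV[R]_d).
Hypothesis V_lattice : forall i, lattice_point (V i).
Hypothesis V_unit : homog_rows V \in unitmx.

Lemma simplex_lattice_basis : lattice_basis (homog_rows V).
Proof.
split=> // i; last exact: homog_rows1.
by rewrite rowK; apply/(lattice_point_homog 1).
Qed.

(** The cone over a simplex is a single closed cell. *)
Lemma simplex_lattice_count k : lattice_count (dilate k (convex_hull V)) =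
  (\sum_(j < d.+1) box_count (homog_rows V) pred0 j * 'C(k + d - j, d))%N.
Proof.
have coneE : cone (homog_rows V) = half_open_cone (homog_rows V) pred0.
  apply/seteqP; split=> [x [a [a0 ->]] i|x Cx]; first by rewrite /= coords_mul.
  by exists (coords (homog_rows V) x); rewrite coordsK.
have N0 : exists i : 'I_d.+1, ~~ pred0 i by exists ord0.
have [fA <-] := card_half_open_cone k simplex_lattice_basis N0.
by rewrite lattice_count_dilate // coneE.
Qed.

End UnitSimplicialCone.

Definition block_sign (R : realType) (p t : nat) : R :=
  if (t < p)%N then -1 else if (t < 2 * p)%N then 1 else 0.

(** The origin, all but the last unit vectors, and one point at lattice
distance m from their hyperplane. *)
Definition simplex_vertex (R : realType) (e p m : nat) (s : 'I_e.+2) :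
    'rV[R]_e.+1 :=
  if unlift ord0 s is Some i then
    if i == ord_max then
      \row_t (if t == ord_max then m%:R else block_sign R p t)
    else delta_mx 0 i
  else 0.

Section Simplex.
Variables (R : realType) (e p m : nat).
Hypothesis p_le : (2 * p <= e)%N.
Hypothesis m_gt0 : (0 < m)%N.
Let d := e.+1.
Local Notation V := (@simplex_vertex R e p m).

Lemma simplex_comb (a : 'I_d.+1 -> R) t : (\sum_s a s *: V s) 0 t =
  if t == ord_max then a ord_max * m%:R
  else a (lift ord0 t) + a ord_max * block_sign R p t.
Proof.
have last : lift ord0 (ord_max : 'I_d) = ord_max by apply: val_inj.
rewrite big_ord_recl {1}/simplex_vertex unlift_none scaler0 add0r summxE (bigD1
  ord_max) //=.
rewrite {1}/simplex_vertex liftK eqxx !mxE last.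
rewrite (eq_bigr (fun i => a (lift ord0 i) * (t == i)%:R)); last first.
  by move=> i /negPf im; rewrite mxE /simplex_vertex liftK im mxE eqxx.
case: ifP => [/eqP ->|/negbT tm].
  by rewrite big1 ?addr0 // => i im; rewrite eq_sym (negPf im) mulr0.
rewrite (bigD1 t) //= eqxx mulr1 big1 ?addr0 1?addrC // => i /andP[_ it].
by rewrite eq_sym (negPf it) mulr0.
Qed.

Let mR_neq0 : m%:R != 0 :> R. Proof. by rewrite pnatr_eq0 -lt0n. Qed.

Lemma simplex_lattice s : lattice_point (V s).
Proof.
move=> t; rewrite /simplex_vertex; case: unlift => [i|];
  last by rewrite mxE rpred0.
case: ifP => _; rewrite mxE.
  case: ifP => _; first exact: natr_int.
  by rewrite /block_sign; case: ifP => _; [|case: ifP => _];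
    rewrite ?rpredN ?int_num1 ?int_num0.
exact: natr_int.
Qed.

Lemma simplex_comb_eq0 (a : 'I_d.+1 -> R) : \sum_s a s *: V s = 0 ->
  forall t, a (lift ord0 t) = 0.
Proof.
move=> a0; have last : lift ord0 (ord_max : 'I_d) = ord_max by apply: val_inj.
have at0 t := simplex_comb a t; rewrite a0 in at0.
have am : a ord_max = 0.
  have := at0 ord_max; rewrite mxE eqxx => /esym/eqP.
  by rewrite mulf_eq0 (negPf mR_neq0) orbF => /eqP.
move=> t; have [->|tm] := eqVneq t ord_max; first by rewrite last.
by have := at0 t; rewrite mxE (negPf tm) am mul0r addr0.
Qed.

Lemma simplex_unit : homog_rows V \in unitmx.
Proof.
rewrite -row_free_unit; apply: inj_row_free => a aW.
have /homog_inj[s0 /simplex_comb_eq0 a0] :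
    homog (\sum_i a 0 i) (\sum_i a 0 i *: V i) = homog 0 0.
  rewrite -mul_homog_rows aW; apply/rowP => j; rewrite !mxE.
  by case: unlift => [i|] //; rewrite mxE.
apply/rowP => s; rewrite mxE; case: (unliftP ord0 s) => [t|] -> //.
by move: s0; rewrite big_ord_recl big1 ?addr0.
Qed.

Local Notation P := (convex_hull V).

Lemma simplex_convex_lattice_polytope : convex_lattice_polytope P.
Proof.
split; first by exists d.+1, V.
by move=> v /vertex_convex_hull[s ->]; exact: simplex_lattice.
Qed.

Lemma simplex_affine_dim : affine_dim P = d.
Proof.
apply/affine_dim_full => //; have V0 : V ord0 = 0
  by rewrite /simplex_vertex unlift_none.
exists 0, (\matrix_i V (lift ord0 i)); split.
- by rewrite -V0; exact: convex_hull_vertex.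
- by move=> i; rewrite add0r rowK; exact: convex_hull_vertex.
- apply: inj_row_free => a; rewrite mulmx_sum_row => a0; apply/rowP => t.
  pose b (s : 'I_d.+1) := if unlift ord0 s is Some i then a 0 i else 0.
  have : \sum_s b s *: V s = 0.
    rewrite big_ord_recl V0 scaler0 add0r -[RHS]a0; apply: eq_bigr => i _.
    by rewrite /b liftK rowK.
  by move=> /simplex_comb_eq0/(_ t); rewrite /b liftK mxE.
Qed.

(** Box points have a multiple u of 1/m as last coordinate. If u is not 0, then
among all coordinates u and 1 - u occur p + 1 times each, whence the height is
p + 1. *)
Let u (k : nat) : R := k%:R / m%:R.
Let w (k : nat) : R := if k == 0%N then 0 else 1 - u k.

Let lam (k : nat) (s : 'I_d.+1) : R :=
  if unlift ord0 s is Some t then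
    if t == ord_max then u k
    else if (t < p)%N then u k else if (t < 2 * p)%N then w k else 0
  else w k.

Let box_pt k : 'rV[R]_d.+1 := (\row_s lam k s) *m homog_rows V.

Let ht (k : nat) : nat := if k == 0%N then 0%N else p.+1.

Lemma lam_bounds k s : (k < m)%N -> 0 <= lam k s < 1.
Proof.
move=> km; have u01 : 0 <= u k < 1.
  by rewrite divr_ge0 // ltr_pdivrMr ?mul1r ?ltr_nat // ltr0n.
have w01 : 0 <= w k < 1.
  rewrite /w; case: (posnP k) => [//|k0]; first by rewrite lexx ltr01.
  have : 0 < u k by rewrite divr_gt0 ?ltr0n.
  lra.
by rewrite /lam; case: unlift => [t|//]; do 3?case: ifP => // _;
  rewrite lexx ltr01.
Qed.

Lemma box_pt_tail k t : tail (box_pt k) 0 t =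
  if t == ord_max then k%:R
  else if (t < p)%N then 0 else if (t < 2 * p)%N then (k != 0%N)%:R else 0.
Proof.
have last : lift ord0 (ord_max : 'I_d) = ord_max by apply: val_inj.
rewrite /box_pt mul_homog_rows homogK simplex_comb !mxE.
have -> : lam k ord_max = u k by rewrite /lam -last liftK eqxx.
case: ifP => tm; first by rewrite /u divfK.
rewrite /lam liftK tm /block_sign; case: ifP => _; first by ring.
case: ifP => _; last by ring.
by rewrite /w /u; case: (posnP k) => [->|k0] /=; ring.
Qed.

Lemma sum_two_blocks (a b : R) :
  \sum_(t < e) (if (t < p)%N then a else if (t < 2 * p)%N then b else 0) =
  p%:R * (a + b).
Proof.
pose F (t : nat) : R := if (t < p)%N then a else if (t < 2 * p)%N then b else 0.
rewrite -(big_mkord xpredT F) (@big_cat_nat _ _ _ (2 * p)) //=.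
rewrite (@big_cat_nat _ _ _ p) //=; last by lia.
rewrite (eq_big_nat _ _ (F2 := fun=> a)); last by move=> i /andP[_ ip];
  rewrite /F ip.
rewrite [X in _ + X + _](eq_big_nat _ _ (F2 := fun=> b)); last first.
  by move=> i /andP[pi ip]; rewrite /F ltnNge pi ip.
rewrite [X in _ + X](eq_big_nat _ _ (F2 := fun=> 0)); last first.
  move=> i /andP[pi _]; rewrite /F ltnNge (leq_trans _ pi) /=; last by lia.
  by rewrite ltnNge pi.
rewrite !sumr_const_nat mul0rn addr0 subn0 mulrDr !mulr_natl.
by congr (_ + _ *+ _); lia.
Qed.

Lemma box_pt_height k : box_pt k 0 ord0 = (ht k)%:R.
Proof.
rewrite /box_pt mul_homog_rows homog0E.
rewrite big_ord_recl big_ord_recr /= mxE /lam unlift_none mxE liftK eqxx.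
rewrite (eq_bigr (fun t : 'I_e => if (t < p)%N then u k else
    if (t < 2 * p)%N then w k else 0)); last first.
  by move=> t _; rewrite mxE liftK -val_eqE /= ltn_eqF.
rewrite sum_two_blocks /ht /w; case: (posnP k) => [->|k0] /=.
  by rewrite /u mul0r; ring.
by rewrite -natr1; ring.
Qed.

Lemma box_pt_lattice k : lattice_point (box_pt k).
Proof.
rewrite -(tailK (box_pt k)) box_pt_height; apply/lattice_point_homog => t.
rewrite box_pt_tail; case: ifP => _; first exact: natr_int.
by case: ifP => _; [|case: ifP => _]; rewrite ?natr_int ?rpred0.
Qed.

Lemma box_ptP x : half_open_box (homog_rows V) pred0 x <->
  exists2 k, (k < m)%N & x = box_pt k.
Proof.
have last : lift ord0 (ord_max : 'I_d) = ord_max by apply: val_inj.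
have uB := simplex_unit; split; last first.
  move=> [k km ->]; split; first exact: box_pt_lattice.
  by move=> s; rewrite /= coords_mul // mxE; exact: lam_bounds.
move=> [lx bx]; pose a := coords (homog_rows V) x.
have xa : x = a *m homog_rows V by rewrite coordsK.
have lt t : tail x 0 t \is a Num.int by rewrite mxE; exact: lx.
have tx : tail x = \sum_s a 0 s *: V s by rewrite xa mul_homog_rows homogK.
have a01 s : 0 <= a 0 s < 1 := bx s.
have amZ : a 0 ord_max * m%:R \is a Num.nat.
  rewrite natrEint mulr_ge0 ?andbT //; last by case/andP: (a01 ord_max).
  by have := lt ord_max; rewrite tx simplex_comb eqxx.
have /natrP[k amk] := amZ.
have amE : a 0 ord_max = u k by rewrite /u -amk mulfK.
have km : (k < m)%N.
  by rewrite -(ltr_nat R) -amk gtr_pMl ?ltr0n //; case/andP: (a01 ord_max).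
exists k => //; have lamb s := lam_bounds s km.
have small (y z : R) : 0 <= y < 1 -> 0 <= z < 1 -> y - z \is a Num.int -> y = z.
  move=> y01 z01 /norm_intr_ge1 yz; apply/eqP; rewrite -subr_eq0.
  by apply/negPn/negP => /yz; rewrite leNgt => /negP; apply; rewrite ltr_norml;
    lra.
have at_ t : a 0 (lift ord0 t) = lam k (lift ord0 t).
  have [->|tm] := eqVneq t ord_max; first by rewrite
    last amE /lam -last liftK eqxx.
  apply: small; [exact: a01|exact: lamb|].
  have -> : a 0 (lift ord0 t) - lam k (lift ord0 t) = tail x 0 t
    - tail (box_pt k) 0 t.
    rewrite tx /box_pt mul_homog_rows homogK !simplex_comb (negPf tm)
      ![(\row__ _) 0 _]mxE amE.
    have -> : lam k ord_max = u k by rewrite /lam -last liftK eqxx.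
    by ring.
  by rewrite rpredB // mxE; exact: box_pt_lattice.
rewrite xa /box_pt; congr (_ *m _); apply/rowP => s; rewrite [RHS]mxE.
case: (unliftP ord0 s) => [t|] -> //.
apply: small; [exact: a01|exact: lamb|].
have hx : x 0 ord0 = \sum_s a 0 s by rewrite xa mul_homog_rows homog0E.
have hb : box_pt k 0 ord0 = \sum_s lam k s.
  by rewrite /box_pt mul_homog_rows homog0E; apply: eq_bigr => i _; rewrite mxE.
have -> : a 0 ord0 - lam k ord0 = x 0 ord0 - box_pt k 0 ord0.
  have es : \sum_(t < d) a 0 (lift ord0 t) = \sum_(t < d) lam k (lift ord0 t).
    exact: eq_bigr.
  by rewrite hx hb big_ord_recl [X in _ = _ - X]big_ord_recl es; ring.
by rewrite rpredB ?lx ?box_pt_lattice.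
Qed.

Lemma simplex_box_count j : box_count (homog_rows V) pred0 j =
  ((j == 0%N) + (j == p.+1) * m.-1)%N.
Proof.
pose s := [seq box_pt k | k <- iota 0 m & ht k == j].
have -> : box_count (homog_rows V) pred0 j = size s.
  apply: card_fset_set_uniq.
    rewrite map_inj_uniq ?filter_uniq ?iota_uniq // => k k' /(congr1 (fun x =>
      tail x 0 ord_max)).
    by rewrite !box_pt_tail eqxx => /eqP; rewrite eqr_nat => /eqP.
  move=> x; split=> [/mapP[k]|[/box_ptP[k km ->]]].
    rewrite mem_filter mem_iota => /andP[/eqP <- km] ->.
    by split; [apply/box_ptP; exists k|exact: box_pt_height].
  rewrite /level /= box_pt_height => /eqP; rewrite eqr_nat => htj.
  by apply/mapP; exists k => //; rewrite mem_filter htj mem_iota.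
rewrite size_map size_filter -[in iota 0 m](prednK m_gt0) /= eq_sym; congr addn.
rewrite (eq_in_count (a2 := fun=> j == p.+1)).
  by case: (j == p.+1); rewrite ?count_predT ?count_pred0 ?size_iota ?mul1n.
by move=> k; rewrite mem_iota /ht eq_sym => /andP[k0 _]; case: k k0.
Qed.

End Simplex.

(** With p = j - 1 there are m - 1 box points of height j besides the origin,
so the h-vector is 1 at index 0 and m - 1 at index j. *)
Lemma exists_sharp_simplex (R : realType) (d j m : nat) : (0 < m)%N ->
  (0 < j)%N -> (2 * j <= d.+1)%N ->
  exists P : set 'rV[R]_d,
  [/\ convex_lattice_polytope P, affine_dim P = d, vol P = m%:R / d`!%:R &
      forall i, ehrhart_coef i P =
        (numerator_coef R d 0 i + numerator_coef R d j i * (m%:R - 1))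
          / d`!%:R].
Proof.
case: d => [|e]; first by lia.
case: j => // p m0 _ pe; have {}pe : (2 * p <= e)%N by lia.
have lV := @simplex_lattice R e p m; have uW := simplex_unit R e p m0.
have countP := simplex_lattice_count lV uW.
set h := box_count _ _ in countP; have hE : forall j, h j = _ :=
  simplex_box_count R pe m0.
have sum_h (F : nat -> R) :
    \sum_(i < e.+2) (h i)%:R * F i = F 0%N + F p.+1 * (m%:R - 1).
  have pe2 : (p < e.+1)%N by lia.
  rewrite big_ord_recl hE eqxx /= mul0n addn0 mul1r; congr (_ + _).
  rewrite (bigD1 (Ordinal pe2)) //= big1 ?addr0 => [|i ip].
    rewrite hE /bump /= add1n eqxx mul1n add0n mulrC -subn1 natrB //.
  rewrite hE /bump /= add1n eqSS; have /negPf -> : i != p :> nat.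
    by apply: contraNneq ip => ep; apply/eqP; apply: val_inj.
  by rewrite mul0r.
exists (convex_hull (@simplex_vertex R e p m)); split;
  [exact: simplex_convex_lattice_polytope|by apply: simplex_affine_dim| |].
- rewrite (vol_convex_hull lV _ _ countP) //; last by rewrite row_full_unit.
  rewrite natr_sum; congr (_ / _); have sum1 := sum_h (fun=> 1).
  have -> : \sum_(i < e.+2) (h i)%:R = \sum_(i < e.+2) (h i)%:R * 1 :> R.
    by apply: eq_bigr => i _; rewrite mulr1.
  by rewrite sum1; ring.
- by move=> i; rewrite (ehrhart_coef_hstar _ countP)
    (sum_h (fun j => numerator_coef R e.+1 j i)).
Qed.

Theorem corollary1p2 (R : realType) (d : nat) (hd : (3 <= d)%N) :
  (forall P : set 'rV[R]_d,
     convex_lattice_polytope P -> affine_dim P = d ->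
     [/\ ehrhart_coef 1 P >= g1_bound d (vol P),
         ehrhart_coef 2 P >= g2_bound d (vol P) &
         ehrhart_coef (d - 2) P >= gdm2_bound d (vol P)])
  /\
  (forall m : nat, (0 < m)%N ->
     [/\ exists P : set 'rV[R]_d,
           [/\ convex_lattice_polytope P, affine_dim P = d,
               vol P = m%:R / d`!%:R &
               ehrhart_coef 1 P = g1_bound d (vol P)],
         exists P : set 'rV[R]_d,
           [/\ convex_lattice_polytope P, affine_dim P = d,
               vol P = m%:R / d`!%:R &
               ehrhart_coef 2 P = g2_bound d (vol P)] &
         exists P : set 'rV[R]_d,
           [/\ convex_lattice_polytope P, affine_dim P = d,
               vol P = m%:R / d`!%:R &
               ehrhart_coef (d - 2) P = gdm2_bound d (vol P)]]).
Proof.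
have d2 : (2 <= d)%N by lia.
have d0 : (0 < d)%N by lia.
split=> [P [polyP latP] dimP|m m0].
  have [n [V [PV vertV]]] := convex_polytope_vertices polyP.
  have lV i : lattice_point (V i) by apply: latP.
  rewrite PV in dimP vertV *.
  have fW := row_full_homog_rows d0 dimP.
  have [h [countP h0 hd1]] := ehrhart_hstar lV fW d0.
  have bound := lower_bounds R hd h0 (hd1 vertV).
  rewrite (vol_convex_hull lV fW d0 countP) !(ehrhart_coef_hstar _ countP).
  rewrite g1_boundE // g2_boundE // gdm2_boundE // !ler_pM2r ?invr_gt0 ?ltr0n
    ?fact_gt0 //.
  split; [apply: (bound (1, 2)%N)|apply: (bound (2, 2)%N)|
          apply: (bound (d - 2, uphalf d)%N)]; by rewrite !inE eqxx ?orbT.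
have sharp j i (bnd : R -> R) : (0 < j)%N -> (2 * j <= d.+1)%N ->
    bnd (m%:R / d`!%:R) =
      (numerator_coef R d 0 i + numerator_coef R d j i * (m%:R - 1)) / d`!%:R ->
    exists P : set 'rV[R]_d,
      [/\ convex_lattice_polytope P, affine_dim P = d, vol P = m%:R / d`!%:R &
          ehrhart_coef i P = bnd (vol P)].
  move=> j0 jd bndE; have [P [? ? volP coefP]] :=
    exists_sharp_simplex R m0 j0 jd.
  by exists P; split; rewrite // volP bndE.
split.
- by apply: (sharp 2); [|lia|exact: g1_boundE].
- by apply: (sharp 2); [|lia|exact: g2_boundE].
- apply: (sharp (uphalf d)); [|rewrite uphalf_half; have := odd_double_half d;
  lia|exact: gdm2_boundE].
  by rewrite uphalf_half; have := odd_double_half d; lia.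
Qed.
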